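(* Let $n\in\mathbb{N}$, let $\mathcal{O}\subset\mathbb{C}^n$ be an open set, let $0<p\in\mathbb{R}$, let $w:\mathcal{O}\to[-\infty,+\infty]$ be a function locally integrable with respect to Lebesgue measure $\lambda$, and let $f$ be a holomorphic function on $\mathcal{O}$ such that $$\|f\|_w:=\Bigl(\int_{\mathcal{O}}|f|^p e^{-w}\,d\lambda\Bigr)^{1/p}<+\infty .$$ Then for every $z\in\mathcal{O}$ $$\ln|f(z)|\le \frac1p\,\inf_{0<r<\operatorname{dist}(z,\mathbb{C}^n\setminus\mathcal{O})}\Bigl(B_w(z,r)+2n\ln\frac1r\Bigr)+\ln\|f\|_w+\frac1p\ln\frac{n!}{\pi^n}.$$
   Context: $\mathbb{C}^n$ is identified with $\mathbb{R}^{2n}$, $\lambda$ is Lebesgue measure, $B(z,r)$ is the open Euclidean ball of radius $r$ centred at $z$, and $\operatorname{dist}$ is Euclidean distance with $\operatorname{dist}(\cdot,\varnothing):=+\infty$. For a function $w$ integrable on $B(z,r)$, $$B_w(z,r):=\frac{1}{\lambda(B(z,r))}\int_{B(z,r)}w\,d\lambda=\frac{n!}{\pi^n r^{2n}}\int_{B(z,r)}w\,d\lambda$$ is the mean of $w$ over the ball. Convention: $\ln 0=-\infty$. *)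

(* Defs.v *)
From HB Require Import structures.
From mathcomp Require Import all_boot all_order all_algebra.
From mathcomp Require Import all_classical all_reals all_analysis.
From mathcomp Require Import measurable_realfun.
From mathcomp Require Import complex.

Set Implicit Arguments.
Unset Strict Implicit.
Unset Printing Implicit Defensive.

Import Order.TTheory GRing.Theory Num.Theory.
Import numFieldNormedType.Exports.

Local Open Scope classical_set_scope.
Local Open Scope ring_scope.

(* Bundling [R[i]] as a [numFieldType] makes the topological and normed
   structures of a [numFieldType] available on it and on ['rV[Cplx R]_n]. *)
Definition Cplx (R : realType) : numFieldType := R[i].

Section product_power.
Local Open Scope ereal_scope.
Context d (T : measurableType d) (R : realType).
Variable mu : {sigma_finite_measure set T -> \bar R}.

Definition tcons n (p : n.-tuple T * T) : n.+1.-tuple T :=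
  [the n.+1.-tuple T of p.2 :: p.1].

Lemma measurable_tcons n : measurable_fun setT (@tcons n).
Proof. exact: measurable_cons measurable_snd measurable_fst. Qed.

Definition product_succ n (nu : {measure set (n.-tuple T) -> \bar R}) :
  set (n.+1.-tuple T) -> \bar R := pushforward (nu \x mu) (@tcons n).

Section product_succ_measure.
Variables (n : nat) (nu : {measure set (n.-tuple T) -> \bar R}).

Let m : {measure set (n.+1.-tuple T) -> \bar R} :=
  measure_function_pushforward__canonical__measure_function_Measure
    (nu \x mu) (@measurable_tcons n).

HB.instance Definition _ := isMeasure.Build _ _ _ (product_succ nu)
  (measure0 m) (measure_ge0 m) (@measure_semi_sigma_additive _ _ _ m).

End product_succ_measure.

(* The [n]-fold product measure of [mu] on [n.-tuple T]; for [n = 0] it is the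
   unit mass at the empty tuple. *)
Fixpoint product_power n : {measure set (n.-tuple T) -> \bar R} :=
  match n with
  | 0 => \d_([tuple] : 0.-tuple T)
  | m.+1 => product_succ (product_power m)
  end.

End product_power.

Section lebesgue_Cn.
Local Open Scope ereal_scope.
Context (R : realType) (n : nat).

(* Real coordinates are interleaved: Re z_0, Im z_0, Re z_1, Im z_1, and so on. *)
Definition Cn_of_reals (t : n.*2.-tuple (measurableTypeR R)) : 'rV[Cplx R]_n :=
  \row_(j < n) (nth 0%R t j.*2 +i* nth 0%R t j.*2.+1)%C.

(* The outer measure on C^n induced by the product Lebesgue measure on the
   Borel sets of R^2n.  The measurable sets of [Cn] below are its Caratheodory
   measurable sets, so that [lambda] is the complete Lebesgue measure. *)
Definition lebesgue_outer (A : set 'rV[Cplx R]_n) : \bar R :=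
  ((product_power (@lebesgue_measure R) n.*2)^*)%mu (Cn_of_reals @^-1` A).

Let lebesgue_outer0 : lebesgue_outer set0 = 0.
Proof. by rewrite /lebesgue_outer preimage_set0 outer_measure0. Qed.

Let lebesgue_outer_ge0 A : 0 <= lebesgue_outer A.
Proof. exact: outer_measure_ge0. Qed.

Let le_lebesgue_outer : {homo lebesgue_outer : A B / A `<=` B >-> A <= B}.
Proof. by move=> A B AB; apply: le_outer_measure; exact: preimage_subset. Qed.

Let lebesgue_outer_sigma_subadditive : sigma_subadditive lebesgue_outer.
Proof.
move=> F; rewrite /lebesgue_outer preimage_bigcup.
exact: outer_measure_sigma_subadditive.
Qed.

HB.instance Definition _ := isOuterMeasure.Build R 'rV[Cplx R]_n lebesgue_outer
  lebesgue_outer0 lebesgue_outer_ge0 le_lebesgue_outer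
  lebesgue_outer_sigma_subadditive.

Definition Cn : Type := caratheodory_type lebesgue_outer.

HB.instance Definition _ := Measurable.on Cn.

Definition lambda : set Cn -> \bar R := lebesgue_outer.

HB.instance Definition _ := isMeasure.Build _ _ _ lambda
  (@caratheodory_measure0 _ _ lebesgue_outer)
  (@caratheodory_measure_ge0 _ _ lebesgue_outer)
  (@caratheodory_measure_sigma_additive _ _ lebesgue_outer).

End lebesgue_Cn.
Arguments lambda {R n}.

Section functions_on_Cn.
Context (R : realType) (n : nat).
Implicit Types (O : set 'rV[Cplx R]_n) (z : 'rV[Cplx R]_n) (r p : R).
Implicit Types (f : 'rV[Cplx R]_n -> Cplx R) (w : 'rV[Cplx R]_n -> \bar R).

Definition modulus (c : Cplx R) : R := Normc.normc c.

(* The norm of the library on ['rV_n] is the max norm, which induces the same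
   topology; balls and distances here are Euclidean. *)
Definition enorm z : R := Num.sqrt (\sum_(j < n) modulus (z ord0 j) ^+ 2).

Definition eball z r : set 'rV[Cplx R]_n := [set x | enorm (x - z) < r].

(* [ereal_inf set0 = +oo], so the distance to the empty set is [+oo]. *)
Definition edistance z (A : set 'rV[Cplx R]_n) : \bar R :=
  ereal_inf [set (enorm (x - z))%:E | x in A].

(* Differentiability is over the field of scalars [Cplx R]. *)
Definition holomorphic_on O f := forall z, O z -> differentiable f z.

Local Open Scope ereal_scope.

Definition locally_integrable_on O w :=
  measurable_fun (O : set (Cn R n)) w /\
  forall K, K `<=` O -> compact K -> \int[lambda]_(x in K) `|w x| < +oo.

Definition ball_mean w z r : \bar R :=
  (lambda (eball z r))^-1 * \int[lambda]_(x in eball z r) w x.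

Definition weighted_norm O p w f : \bar R :=
  poweR (\int[lambda]_(x in O) ((modulus (f x) `^ p)%:E * expeR (- w x))) p^-1.

End functions_on_Cn.

(* Main.v *)
From HB Require Import structures.
Require Import Defs.
From mathcomp Require Import all_boot all_order all_algebra.
From mathcomp Require Import all_classical all_reals all_analysis.
From mathcomp Require Import measurable_realfun.
From mathcomp Require Import complex.
From mathcomp Require Import ring lra.

Set Implicit Arguments.
Unset Strict Implicit.
Unset Printing Implicit Defensive.

Import Order.TTheory GRing.Theory Num.Theory.
Import numFieldNormedType.Exports.

Local Open Scope classical_set_scope.
Local Open Scope ring_scope.

(** The left-hand side is compared with the expression under the infimum for each
    radius [r] separately. Let [B] be the ball of radius [r] around [z] and let
    [V = pi^n r^(2n) / n!] be its volume ([volume_eball]). The bound to prove is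

      [p ln |f z| <= mean of w over B + ln (1/V * int_B |f|^p e^-w)].

    It combines the sub-mean value inequality for [ln |f|] over balls
    ([sub_mean_value_log]) with Jensen's inequality for the logarithm: the mean of
    [p ln |f| - w] is at most the logarithm of the mean of [|f|^p e^-w]. The latter
    is the integral of a tangent line inequality ([tangent_line],
    [log_modulus_le_ball]), which is arranged so that only nonnegative functions
    are integrated and zeros of [f] and infinite values of [w] do no harm.

    The sub-mean value inequality rests on the maximum principle
    ([maximum_modulus]) alone. On the complex line through [z] and [x], apply the
    principle to the product over [k < N] of the functions
    [t |-> f (z + t omega^k (x - z))], where [omega] is a primitive [N]-th root of unity:
    [ln |f z|] is at most the maximum over the unit circle of the averages over
    [k] of [ln (max |f| eps)] at these points ([discrete_jensen]). For large [N]
    uniform continuity makes the averages almost independent of [t]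
    ([log_le_rotation_mean]), and Lebesgue measure is invariant under the
    rotations [x |-> z + omega^k (x - z)] ([preserves_isometry]), so integrating over
    [x] in [B] turns the average into the mean of [ln (max |f| eps)] over [B];
    then [eps] tends to [0].

    Holomorphy is pointwise complex differentiability, so the maximum principle
    comes from Goursat's theorem: in logarithmic coordinates a circle is a
    vertical segment, and the theorem for rectangles ([goursat]) says that the
    mean over circles does not depend on the radius.

    On the side of measure theory, a rotation of the plane is a product of
    shears, which preserve area by Fubini's theorem ([preserves_rotation]), and
    the maps of the plane are applied to all complex coordinates at once by
    induction on the dimension ([preserves_tcons2]). The volume of the ball
    follows from the area of the disc by another induction ([volume_sumsq]). *)

(** * Bisection of rectangles *)

Section bisection.
Context (R : realType).
Variables (F : R -> R -> R -> R -> R) (a0 b0 c0 d0 : R).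
Hypotheses (ab0 : a0 <= b0) (cd0 : c0 <= d0).
Hypothesis F_splitx : forall a m b c d, a0 <= a -> a <= m -> m <= b -> b <= b0 ->
  c0 <= c -> c <= d -> d <= d0 -> F a b c d = F a m c d + F m b c d.
Hypothesis F_splity : forall a b c m d, a0 <= a -> a <= b -> b <= b0 ->
  c0 <= c -> c <= m -> m <= d -> d <= d0 -> F a b c d = F a b c m + F a b m d.
Hypothesis F_small : forall x y, a0 <= x <= b0 -> c0 <= y <= d0 ->
  forall e, 0 < e -> exists2 dlt, 0 < dlt & forall a b c d,
    a0 <= a -> a <= x -> x <= b -> b <= b0 ->
    c0 <= c -> c <= y -> y <= d -> d <= d0 ->
    (b - a) + (d - c) < dlt ->
    `|F a b c d| <= e * ((b - a) + (d - c)) ^+ 2.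

Let w k := (b0 - a0) / 2 ^+ k.
Let h k := (d0 - c0) / 2 ^+ k.
Let G k (s : R * R) := F s.1 (s.1 + w k) s.2 (s.2 + h k).
(* [bisect_corner k] is the lower left corner of the [k]-th rectangle, whose
   sides are [w k] and [h k]; [quad] lists the corners of its quarters. *)
Let quad k (s : R * R) (i j : bool) :=
  (s.1 + (if i then w k.+1 else 0), s.2 + (if j then h k.+1 else 0)).
Let good k s q := `|G k s| <= 4 * `|G k.+1 q|.
Let step k s :=
  if good k s (quad k s false false) then quad k s false false else
  if good k s (quad k s false true) then quad k s false true else
  if good k s (quad k s true false) then quad k s true false else
  quad k s true true.
Fixpoint bisect_corner k : R * R :=
  if k is k'.+1 then step k' (bisect_corner k') else (a0, c0).
Let s := bisect_corner.

Let wS k : w k = w k.+1 + w k.+1.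
Proof. by rewrite /w exprS; field; rewrite expf_neq0. Qed.
Let hS k : h k = h k.+1 + h k.+1.
Proof. by rewrite /h exprS; field; rewrite expf_neq0. Qed.
Let w_ge0 k : 0 <= w k.
Proof. by rewrite divr_ge0 ?subr_ge0 ?exprn_ge0. Qed.
Let h_ge0 k : 0 <= h k.
Proof. by rewrite divr_ge0 ?subr_ge0 ?exprn_ge0. Qed.

Let stepP k p : exists i j, step k p = quad k p i j.
Proof.
by rewrite /step; do ! case: ifP => _; eexists; eexists; reflexivity.
Qed.

Let s_in k : [/\ a0 <= (s k).1, (s k).1 + w k <= b0, c0 <= (s k).2 &
  (s k).2 + h k <= d0].
Proof.
elim: k => [|k [ha hb hc hd]].
  by rewrite /s /= /w /h expr0 !divr1 !subrKC; split.
have [i [j]] := stepP k (s k); rewrite [s k.+1]/= -/s => -> /=.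
move: (w_ge0 k.+1) (h_ge0 k.+1) (wS k) (hS k) => w0 h0 ew eh.
by split; case: i; case: j; lra.
Qed.

Let s_mono k : [/\ (s k).1 <= (s k.+1).1, (s k.+1).1 + w k.+1 <= (s k).1 + w k,
  (s k).2 <= (s k.+1).2 & (s k.+1).2 + h k.+1 <= (s k).2 + h k].
Proof.
have [i [j]] := stepP k (s k); rewrite [s k.+1]/= -/s => -> /=.
move: (w_ge0 k.+1) (h_ge0 k.+1) (wS k) (hS k) => w0 h0 ew eh.
by split; case: i; case: j; lra.
Qed.

Let s_good k : good k (s k) (s k.+1).
Proof.
rewrite [s k.+1]/= -/s /step; do 3 (case: ifPn => [//|]).
rewrite /good -!ltNge => h1 h2 h3.
have [ha hb hc hd] := s_in k.
move: (w_ge0 k.+1) (h_ge0 k.+1) (wS k) (hS k) => w0 h0 ew eh.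
set u1 := G _ (quad _ _ false false) in h1 h2 h3 *.
set u2 := G _ (quad _ _ false true) in h1 h2 h3 *.
set u3 := G _ (quad _ _ true false) in h1 h2 h3 *.
set u4 := G _ (quad _ _ true true) in h1 h2 h3 *.
have E : G k (s k) = u1 + u2 + (u3 + u4).
  rewrite /u1 /u2 /u3 /u4 /G /quad /= !addr0.
  rewrite (@F_splitx _ ((s k).1 + w k.+1)) ; try lra.
  rewrite (@F_splity _ _ _ ((s k).2 + h k.+1)); try lra.
  rewrite (@F_splity ((s k).1 + w k.+1) _ _ ((s k).2 + h k.+1)); try lra.
  by rewrite ew eh !addrA.
have := ler_normD (u1 + u2) (u3 + u4).
have := ler_normD u1 u2; have := ler_normD u3 u4.
by move: h1 h2 h3; rewrite E; lra.
Qed.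

Let s_le j k : (j <= k)%N -> [/\ (s j).1 <= (s k).1,
  (s k).1 + w k <= (s j).1 + w j, (s j).2 <= (s k).2 &
  (s k).2 + h k <= (s j).2 + h j].
Proof.
move=> /subnKC <-; elim: (k - j)%N => [|i [? ? ? ?]]; first by rewrite addn0.
by rewrite addnS; have [? ? ? ?] := s_mono (j + i); split; lra.
Qed.

Let s_geo k : `|F a0 b0 c0 d0| <= 4 ^+ k * `|G k (s k)|.
Proof.
elim: k => [|k IH].
  by rewrite expr0 mul1r /G /s /= /w /h expr0 !divr1 !subrKC.
rewrite (le_trans IH)// exprSr -mulrA ler_wpM2l ?exprn_ge0//; exact: s_good.
Qed.

Let nested (u v : nat -> R) :
  (forall j k, (j <= k)%N -> u j <= u k) ->
  (forall j k, (j <= k)%N -> u k + v k <= u j + v j) ->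
  (forall k, 0 <= v k) -> exists x, forall k, u k <= x <= u k + v k.
Proof.
move=> um vm v0; exists (sup (range u)) => k.
have ub : ubound (range u) (u k + v k).
  move=> _ [j _ <-]; have [jk|/ltnW kj] := leqP j k.
    by rewrite (le_trans (um _ _ jk))// lerDl.
  by rewrite (le_trans _ (vm _ _ kj))// lerDl.
apply/andP; split; last by apply: ge_sup => //; exists (u 0%N), 0%N.
by apply: ub_le_sup; [exists (u k + v k)|exists k].
Qed.

(** Some quarter of a rectangle carries at least a quarter of its value. Keeping
    such a quarter again and again leads to a point near which the value is not
    small compared with the area, unless the value was zero from the start. *)
Lemma bisection_eq0 : F a0 b0 c0 d0 = 0.
Proof.
have [x xP] : exists x, forall k, (s k).1 <= x <= (s k).1 + w k.
  by apply: nested => // j k /s_le[].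
have [y yP] : exists y, forall k, (s k).2 <= y <= (s k).2 + h k.
  by apply: nested => // j k /s_le[].
pose L := (b0 - a0) + (d0 - c0).
have L0 : 0 <= L by rewrite /L addr_ge0 ?subr_ge0.
apply/eqP; rewrite -normr_le0; apply/ler_addgt0Pr => e e0; rewrite add0r.
have e'0 : 0 < e / (L ^+ 2 + 1).
  by rewrite divr_gt0// ltr_wpDl// sqr_ge0.
have x0 : a0 <= x <= b0 by have := xP 0%N; rewrite /s /= /w expr0 divr1 subrKC.
have y0 : c0 <= y <= d0 by have := yP 0%N; rewrite /s /= /h expr0 divr1 subrKC.
have [dlt dlt0 small] := F_small x0 y0 e'0.
have wh k : w k + h k = L / 2 ^+ k by rewrite /w /h -mulrDl.
have [k Lk] : exists k, L / 2 ^+ k < dlt.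
  exists (Num.bound (L / dlt)); rewrite ltr_pdivrMr ?exprn_gt0// -ltr_pdivrMl//.
  rewrite mulrC; apply: lt_le_trans (_ : (Num.bound (L / dlt))%:R <= _).
    by rewrite archi_boundP// divr_ge0// ltW.
  by rewrite -natrX ler_nat ltnW// ltn_expl.
have [ha hb hc hd] := s_in k.
have := s_geo k; have/andP[x1 x2] := xP k; have /andP[y1 y2] := yP k.
have := @small (s k).1 ((s k).1 + w k) (s k).2 ((s k).2 + h k) ha x1 x2 hb hc y1 y2 hd.
rewrite -/(G k (s k)) !(addrAC _ _ (- _)) !subrr !add0r wh => /(_ Lk) hG h4.
rewrite (le_trans h4)// (le_trans (ler_wpM2l _ hG)) ?exprn_ge0//.
rewrite expr_div_n -exprM mulnC exprM.
have -> : (2 : R) ^+ 2 = 4 by rewrite expr2; lra.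
have -> : 4 ^+ k * (e / (L ^+ 2 + 1) * (L ^+ 2 / 4 ^+ k)) = e * (L ^+ 2 / (L ^+ 2 + 1)).
  have : (4 : R) ^+ k != 0 by rewrite expf_neq0.
  have : L ^+ 2 + 1 != 0 by rewrite gt_eqF// ltr_wpDl// sqr_ge0.
  by move=> ? ?; field; apply/andP.
rewrite ler_piMr ?(ltW e0)// ler_pdivrMr ?ltr_wpDl ?sqr_ge0//; lra.
Qed.

End bisection.

(** * Goursat's theorem for rectangles *)

Section segment_integral.
Context (R : realType).
Implicit Types (f g : R -> R) (a b : R).
Local Notation mu := (@lebesgue_measure R).

Definition segint f a b : R := (\int[mu]_(x in `[a, b]) f x)%R.

Definition cont_on f a b := forall x, a <= x <= b -> {for x, continuous f}.

Lemma cont_on_sub f a b a' b' : a <= a' -> b' <= b -> cont_on f a b -> cont_on f a' b'.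
Proof. by move=> aa bb fc x /andP[x1 x2]; apply: fc; lra. Qed.

Lemma cont_onB f g a b : cont_on f a b -> cont_on g a b -> cont_on (f \- g) a b.
Proof. by move=> fc gc x xab; apply: cvgB; [exact: fc|exact: gc]. Qed.

Lemma cont_on_integrable f a b : cont_on f a b -> mu.-integrable `[a, b] (EFin \o f).
Proof.
move=> fc; apply: continuous_compact_integrable; first exact: segment_compact.
apply: continuous_in_subspaceT => x; rewrite inE/= in_itv/= => xab; exact: fc.
Qed.

Lemma segint_split f a m b : a <= m -> m <= b -> cont_on f a b ->
  segint f a b = segint f a m + segint f m b.
Proof.
move=> am mb fc; rewrite /segint.
have := @Rintegral_itvB R f (BLeft a) (BRight b) m (cont_on_integrable fc).
rewrite !bnd_simp => /(_ am mb) E.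
have fi : mu.-integrable `]m, b] (EFin \o f).
  apply: integrableS (cont_on_integrable (cont_on_sub am (lexx b) fc)) => //.
  by apply: subset_itvr; rewrite bnd_simp.
by rewrite -(Rintegral_itv_obnd_cbnd fi) -E subrKC.
Qed.

Lemma segintB f g a b : cont_on f a b -> cont_on g a b ->
  segint (f \- g) a b = segint f a b - segint g a b.
Proof. by move=> fc gc; apply: RintegralB => //; exact: cont_on_integrable. Qed.

Lemma segint_cst k a b : a <= b -> segint (cst k) a b = k * (b - a).
Proof.
move=> ab; rewrite /segint Rintegral_cst//= lebesgue_measure_itv/= lte_fin.
by case: ltgtP ab => // ->; rewrite subrr.
Qed.

Lemma le_segint f g a b : cont_on f a b -> cont_on g a b ->
  (forall x, a <= x <= b -> f x <= g x) -> segint f a b <= segint g a b.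
Proof.
move=> fc gc fg; apply: le_Rintegral => //; try exact: cont_on_integrable.
Qed.

Lemma segint_near f k e a b : a <= b -> cont_on f a b ->
  (forall x, a <= x <= b -> `|f x - k| <= e) ->
  `|segint f a b - k * (b - a)| <= e * (b - a).
Proof.
move=> ab fc fk.
have cc c : cont_on (cst c) a b by move=> x _; exact: cvg_cst.
have h1 := @le_segint (cst (k - e)) f a b (cc _) fc.
have h2 := @le_segint f (cst (k + e)) a b fc (cc _).
rewrite !segint_cst// in h1 h2.
have {}h1 : (k - e) * (b - a) <= segint f a b.
  by apply: h1 => x /fk; rewrite ler_distl => /andP[].
have {}h2 : segint f a b <= (k + e) * (b - a).
  by apply: h2 => x /fk; rewrite ler_distl => /andP[].
by rewrite ler_distl; apply/andP; split; lra.
Qed.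

End segment_integral.

Section goursat.
Context (R : realType).
(* [U] and [V] are the real and imaginary parts of a complex function of
   [x + i y]; in [UV_diff] the complex derivative is [A + i B]. *)
Variables (U V : R -> R -> R) (a0 b0 c0 d0 : R).
Hypotheses (ab0 : a0 <= b0) (cd0 : c0 <= d0).
Hypothesis U_cont : forall x, a0 <= x <= b0 -> cont_on (U x) c0 d0.
Hypothesis V_cont : forall y, c0 <= y <= d0 -> cont_on (V ^~ y) a0 b0.
Hypothesis UV_diff : forall x y, a0 <= x <= b0 -> c0 <= y <= d0 ->
  exists A B : R, forall e, 0 < e -> exists2 dlt, 0 < dlt & forall x' y',
    `|x' - x| + `|y' - y| < dlt ->
    `|U x' y' - U x y - (A * (x' - x) - B * (y' - y))|
      <= e * (`|x' - x| + `|y' - y|) /\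
    `|V x' y' - V x y - (B * (x' - x) + A * (y' - y))|
      <= e * (`|x' - x| + `|y' - y|).

(* The imaginary part of the contour integral over the boundary. *)
Let F a b c d := segint (U b) c d - segint (U a) c d
                 - (segint (V ^~ d) a b - segint (V ^~ c) a b).

(** The boundary integral is additive under subdivision and vanishes for complex
    affine functions, so over a small rectangle it only sees the error of the first
    order expansion, which is negligible compared with the area. *)
Lemma goursat : segint (U b0) c0 d0 - segint (U a0) c0 d0
              = segint (V ^~ d0) a0 b0 - segint (V ^~ c0) a0 b0.
Proof.
apply/eqP; rewrite -subr_eq0; apply/eqP; rewrite -/(F a0 b0 c0 d0).
apply: bisection_eq0 => //.
- move=> a m b c d ? ? ? ? ? ? ?; rewrite /F.
  rewrite (@segint_split _ (V ^~ d) a m b)//; last first.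
    by apply: (@cont_on_sub _ _ a0 b0) => //; apply: V_cont; lra.
  rewrite (@segint_split _ (V ^~ c) a m b)//; last first.
    by apply: (@cont_on_sub _ _ a0 b0) => //; apply: V_cont; lra.
  by lra.
- move=> a b c m d ? ? ? ? ? ? ?; rewrite /F.
  rewrite (@segint_split _ (U b) c m d)//; last first.
    by apply: (@cont_on_sub _ _ c0 d0) => //; apply: U_cont; lra.
  rewrite (@segint_split _ (U a) c m d)//; last first.
    by apply: (@cont_on_sub _ _ c0 d0) => //; apply: U_cont; lra.
  by lra.
move=> x y xab ycd e e0; have [A [B h]] := UV_diff xab ycd.
have e4 : 0 < e / 4 by lra.
have [dlt dlt0 {}h] := h _ e4.
exists dlt => // a b c d a0a ax xb bb0 c0c cy yd dd0 small.
set L := (b - a) + (d - c) in small *.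
have dist x' y' : a <= x' <= b -> c <= y' <= d -> `|x' - x| + `|y' - y| <= L.
  move=> /andP[? ?] /andP[? ?]; apply: lerD; rewrite ler_norml; lra.
have hU x' y' : a <= x' <= b -> c <= y' <= d ->
    `|U x' y' - U x y - (A * (x' - x) - B * (y' - y))| <= e / 4 * L.
  move=> hx hy; have hd := dist _ _ hx hy.
  apply: le_trans (h _ _ (le_lt_trans hd small)).1 _.
  by rewrite ler_wpM2l// ltW.
have hV x' y' : a <= x' <= b -> c <= y' <= d ->
    `|V x' y' - V x y - (B * (x' - x) + A * (y' - y))| <= e / 4 * L.
  move=> hx hy; have hd := dist _ _ hx hy.
  apply: le_trans (h _ _ (le_lt_trans hd small)).2 _.
  by rewrite ler_wpM2l// ltW.
have ab : a <= b by lra.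
have cd : c <= d by lra.
have cU x' : a <= x' <= b -> cont_on (U x') c d.
  by move=> ?; apply: (@cont_on_sub _ _ c0 d0) => //; apply: U_cont; lra.
have cV y' : c <= y' <= d -> cont_on (V ^~ y') a b.
  by move=> ?; apply: (@cont_on_sub _ _ a0 b0) => //; apply: V_cont; lra.
have aab : a <= a <= b by lra.
have bab : a <= b <= b by lra.
have ccd : c <= c <= d by lra.
have dcd : c <= d <= d by lra.
have HU : `|segint (U b) c d - segint (U a) c d - A * (b - a) * (d - c)|
    <= e / 2 * L * (d - c).
  rewrite -segintB; [|exact: cU..].
  apply: segint_near => //; first by apply: cont_onB; exact: cU.
  move=> y' hy /=; have := hU _ _ bab hy; have := hU _ _ aab hy.
  by rewrite !ler_norml; move=> /andP[? ?] /andP[? ?]; lra.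
have HV : `|segint (V ^~ d) a b - segint (V ^~ c) a b - A * (d - c) * (b - a)|
    <= e / 2 * L * (b - a).
  rewrite -segintB; [|exact: cV..].
  apply: segint_near => //; first by apply: cont_onB; exact: cV.
  move=> x' hx /=; have := hV _ _ hx dcd; have := hV _ _ hx ccd.
  by rewrite !ler_norml; move=> /andP[? ?] /andP[? ?]; lra.
have -> : e * L ^+ 2 = e / 2 * L * (d - c) + e / 2 * L * (b - a) + e / 2 * L ^+ 2.
  by rewrite /L; field.
have : 0 <= e / 2 * L ^+ 2 by rewrite mulr_ge0 ?sqr_ge0//; lra.
move: HU HV; rewrite /F !ler_norml => /andP[? ?] /andP[? ?] ?; lra.
Qed.

End goursat.

(** * Modulus and complex exponential *)

Section modulus_theory.
Context (R : realType).
Implicit Types (x y : Cplx R) (e r : R).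

Lemma modulus_ge0 x : 0 <= modulus x.
Proof. by case: x => a b; rewrite /modulus /= sqrtr_ge0. Qed.

Lemma modulus0 : modulus (0 : Cplx R) = 0.
Proof. exact: Normc.normc0. Qed.

Lemma modulus1 : modulus (1 : Cplx R) = 1.
Proof. exact: Normc.normc1. Qed.

Lemma modulus_eq0 x : modulus x = 0 -> x = 0.
Proof. exact: Normc.eq0_normc. Qed.

Lemma modulusM x y : modulus (x * y) = modulus x * modulus y.
Proof. exact: Normc.normcM. Qed.

Lemma modulusX x n : modulus (x ^+ n) = modulus x ^+ n.
Proof.
by elim: n => [|n IH]; rewrite ?expr0 ?modulus1// !exprS modulusM IH.
Qed.

Lemma modulus_prod I (s : seq I) (F : I -> Cplx R) :
  modulus (\prod_(i <- s) F i) = \prod_(i <- s) modulus (F i).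
Proof. by apply: (big_morph _ modulusM modulus1). Qed.

Lemma norm_modulus x : `|x| = (modulus x)%:C%C.
Proof. by []. Qed.

Lemma modulusD x y : modulus (x + y) <= modulus x + modulus y.
Proof. exact: le_normcD. Qed.

Lemma modulusN x : modulus (- x) = modulus x.
Proof. exact: normcN. Qed.

Lemma modulusB x y : modulus (x - y) = modulus (y - x).
Proof. by rewrite -modulusN opprB. Qed.

Lemma modulus_real r : modulus (r%:C%C : Cplx R) = `|r|.
Proof. by rewrite /modulus /= expr0n addr0 sqrtr_sqr. Qed.

Lemma ltc_real r (e : Cplx R) : 0 < e -> (r%:C%C < e) = (r < complex.Re e).
Proof. by rewrite !ltcE /= => /andP[/eqP -> _]; rewrite eqxx. Qed.

Lemma gt0_complexE (e : Cplx R) : 0 < e -> e = (complex.Re e)%:C%C /\ 0 < complex.Re e.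
Proof. by case: e => a b; rewrite ltcE /= => /andP[/eqP -> ->]. Qed.

Lemma Re_le_modulus x : `|complex.Re x| <= modulus x.
Proof.
case: x => a b; rewrite /modulus /= -sqrtr_sqr ler_wsqrtr//.
by rewrite lerDl sqr_ge0.
Qed.

Lemma Im_le_modulus x : `|complex.Im x| <= modulus x.
Proof.
case: x => a b; rewrite /modulus /= -sqrtr_sqr ler_wsqrtr//.
by rewrite lerDr sqr_ge0.
Qed.

Lemma modulus_le_ReIm x : modulus x <= `|complex.Re x| + `|complex.Im x|.
Proof.
case: x => a b; have E : (a +i* b)%C = a%:C%C + (0 +i* b)%C :> Cplx R.
  by apply/eqP; rewrite eq_complex /= addr0 add0r !eqxx.
rewrite {1}E (le_trans (modulusD _ _))// modulus_real lerD2l.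
by rewrite /modulus /= expr0n add0r sqrtr_sqr.
Qed.

Lemma modulusBRe x y : complex.Re (x - y) = complex.Re x - complex.Re y.
Proof. by case: x y => a b [c d]. Qed.

Lemma modulusBIm x y : complex.Im (x - y) = complex.Im x - complex.Im y.
Proof. by case: x y => a b [c d]. Qed.

End modulus_theory.

Section first_order.

Lemma derivable_first_order (K : numFieldType) (f : K -> K) (x : K) :
  derivable f x 1 -> forall e : K, 0 < e -> exists2 dlt : K, 0 < dlt &
  forall h, `|h| < dlt -> `|f (h + x) - f x - h * 'D_1 f x| <= e * `|h|.
Proof.
move=> /derivable_nbhs /eqaddoP + e e0 => /(_ e e0).
rewrite near_simpl => /nbhs_ballP[dlt /= dlt0 H]; exists dlt => // h hd.
have /= := H h; rewrite /ball /= sub0r normrN => /(_ hd).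
by rewrite !fctE /= /shift /= /GRing.scale /= mulr1 opprD addrA.
Qed.

Context (R : realType).

Lemma is_derive_first_order (f : R -> R) (x d : R) : is_derive x 1 f d ->
  forall e, 0 < e -> exists2 dlt, 0 < dlt &
  forall h, `|h| < dlt -> `|f (h + x) - f x - h * d| <= e * `|h|.
Proof.
move=> fd e e0; have [/derivable_first_order/(_ e e0)[dlt dlt0 H] <-] := fd.
by exists dlt.
Qed.

(** The first order expansion with real error bounds and the real-valued
    modulus in place of the complex-valued norm. *)
Lemma complex_first_order (f : Cplx R -> Cplx R) (x : Cplx R) :
  derivable f x 1 -> exists a : Cplx R, forall e : R, 0 < e ->
  exists2 dlt : R, 0 < dlt &
  forall h, modulus h < dlt -> modulus (f (x + h) - f x - a * h) <= e * modulus h.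
Proof.
move=> /derivable_first_order H; exists ('D_1 f x) => e e0.
have ec0 : 0 < e%:C%C :> Cplx R by rewrite ltcR.
have [dlt dlt0 {}H] := H _ ec0; have [dltE dltr0] := gt0_complexE dlt0.
exists (complex.Re dlt) => // h hd; have := H h.
rewrite !norm_modulus -rmorphM/= lecR (ltc_real _ dlt0) => /(_ hd).
by rewrite [x + h]addrC ['D_1 f x * h]mulrC.
Qed.

End first_order.

Section expc.
Context (R : realType).
Implicit Types x y h k : R.

(** The exponential of [x + i y]. *)
Definition expc x y : Cplx R := (expR x * cos y +i* (expR x * sin y))%C.

Lemma expcD x y h k : expc (x + h) (y + k) = expc x y * expc h k.
Proof.
rewrite /expc expRD cosD sinD; apply/eqP.
by rewrite eq_complex /=; apply/andP; split; apply/eqP; ring.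
Qed.

Lemma expc00 : expc 0 0 = 1.
Proof. by rewrite /expc expR0 cos0 sin0 mulr1 mulr0. Qed.

Lemma modulus_expc x y : modulus (expc x y) = expR x.
Proof.
rewrite /modulus /= !exprMn -mulrDr cos2Dsin2 mulr1 sqrtr_sqr ger0_norm//.
Qed.

Lemma expc_period x : expc x (pi *+ 2) = expc x 0.
Proof. by rewrite /expc cos2pi sin2pi cos0 sin0. Qed.

Lemma expc_first_order e : 0 < e -> exists2 dlt, 0 < dlt & forall h k,
  `|h| + `|k| < dlt ->
  modulus (expc h k - 1 - (h +i* k)%C) <= e * (`|h| + `|k|).
Proof.
move=> e0.
pose e' := Num.min 1 (e / 8).
have e'0 : 0 < e' by rewrite lt_min ltr01 divr_gt0.
have e'1 : e' <= 1 by rewrite ge_min lexx.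
have e'e : e' <= e / 8 by rewrite ge_min lexx orbT.
have [d1 d10 H1] := is_derive_first_order (is_derive_expR (0:R)) e'0.
have [d2 d20 H2] := is_derive_first_order (is_derive_cos (0:R)) e'0.
have [d3 d30 H3] := is_derive_first_order (is_derive_sin (0:R)) e'0.
exists (Num.min (Num.min d1 d2) (Num.min d3 (e' / 2))).
  by rewrite !lt_min d10 d20 d30 divr_gt0.
move=> h k; rewrite !lt_min => /andP[/andP[hk1 hk2] /andP[hk3 hk4]].
have h0 := normr_ge0 h; have k0 := normr_ge0 k.
have {}H1 : `|expR h - 1 - h| <= e' * `|h|.
  have := H1 h; rewrite addr0 expR0 mulr1; apply; lra.
have {}H2 : `|cos k - 1| <= e' * `|k|.
  have := H2 k; rewrite addr0 sin0 oppr0 mulr0 subr0 cos0; apply; lra.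
have {}H3 : `|sin k - k| <= e' * `|k|.
  have := H3 k; rewrite addr0 cos0 sin0 mulr1 subr0; apply; lra.
have e1 : `|expR h - 1| <= e'.
  have -> : expR h - 1 = (expR h - 1 - h) + h by ring.
  have : e' * `|h| <= `|h| by rewrite ler_piMl.
  by have := ler_normD (expR h - 1 - h) h; lra.
have e2 : `|expR h| <= 2.
  by have := ler_normD (expR h - 1) 1; rewrite subrK normr1; lra.
have s2 : `|sin k| <= 2 * `|k|.
  have := ler_normD (sin k - k) k; rewrite subrK.
  by have : e' * `|k| <= `|k| by [rewrite ler_piMl|]; lra.
apply: le_trans (modulus_le_ReIm _) _ => /=.
have -> : expR h * cos k - 1 - h = (expR h - 1 - h) + expR h * (cos k - 1) by ring.
have -> : expR h * sin k - 0 - k = (expR h - 1) * sin k + (sin k - k) by ring.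
have := ler_normD (expR h - 1 - h) (expR h * (cos k - 1)).
have := ler_normD ((expR h - 1) * sin k) (sin k - k).
rewrite !normrM.
have m1 : `|expR h| * `|cos k - 1| <= 2 * (e' * `|k|) by apply: ler_pM.
have m2 : `|expR h - 1| * `|sin k| <= e' * (2 * `|k|) by apply: ler_pM.
have m3 : e' * `|h| <= e / 8 * `|h| by rewrite ler_wpM2r.
have m4 : e' * `|k| <= e / 8 * `|k| by rewrite ler_wpM2r.
have : 0 <= e * `|h| by rewrite mulr_ge0// ltW.
have : 0 <= e * `|k| by rewrite mulr_ge0// ltW.
lra.
Qed.

End expc.

(** * The maximum principle *)

Section mean_value.
Context (R : realType).
Variables (H : Cplx R -> Cplx R).
Hypothesis dH : forall t, modulus t <= 1 -> derivable H t 1.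

Let G x y := H (expc x y).
Let U x y := complex.Re (G x y).
Let V x y := complex.Im (G x y).

Let G_first_order x y : x <= 0 -> exists a : Cplx R, forall e : R, 0 < e ->
  exists2 dlt : R, 0 < dlt & forall x' y', `|x' - x| + `|y' - y| < dlt ->
  modulus (G x' y' - G x y - a * ((x' - x) +i* (y' - y))%C)
    <= e * (`|x' - x| + `|y' - y|).
Proof.
move=> x0; set T := expc x y.
have T1 : modulus T <= 1 by rewrite modulus_expc -expR0 ler_expR.
have [a Ha] := complex_first_order (dH T1); exists (a * T) => e e0.
have a0 := modulus_ge0 a.
pose e1 := Num.min 1 (e / (2 * (modulus a + 1))).
have e10 : 0 < e1 by rewrite lt_min ltr01 divr_gt0// mulr_gt0// ltr_wpDl.
have e11 : e1 <= 1 by rewrite ge_min lexx.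
have ae1 : modulus a * e1 <= e / 2.
  have : e1 <= e / (2 * (modulus a + 1)) by rewrite ge_min lexx orbT.
  rewrite ler_pdivlMr ?mulr_gt0 ?ltr_wpDl// => h.
  have : modulus a * e1 <= (modulus a + 1) * e1 by rewrite ler_wpM2r ?lerDl// ltW.
  by lra.
have e40 : 0 < e / 4 by lra.
have [d1 d10 H1] := expc_first_order e10.
have [d2 d20 H2] := Ha _ e40.
exists (Num.min d1 (d2 / 2)); first by rewrite lt_min d10 divr_gt0.
move=> x' y'; rewrite lt_min; set s := `|_| + _ => /andP[sd1 sd2].
have s0 : 0 <= s by rewrite /s addr_ge0.
have {}H1 := H1 _ _ sd1; rewrite -/s in H1.
set q := ((x' - x) +i* (y' - y))%C in H1 *.
have qs : modulus q <= s by exact: modulus_le_ReIm.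
set r := expc _ _ - 1 - q in H1.
pose eta := T * (expc (x' - x) (y' - y) - 1).
have ET : expc x' y' = T + eta.
  rewrite -{1}(subrKC x x') -{1}(subrKC y y') expcD -/T /eta.
  by rewrite mulrBr mulr1 subrKC.
have Er : eta = T * q + T * r by rewrite /eta /r -mulrDr subrKC.
have Tr : modulus (T * r) <= e1 * s.
  by rewrite modulusM (le_trans (ler_wpM2r (modulus_ge0 _) T1))// mul1r.
have eta_le : modulus eta <= 2 * s.
  rewrite /eta modulusM (le_trans (ler_wpM2r (modulus_ge0 _) T1))// mul1r.
  have -> : expc (x' - x) (y' - y) - 1 = q + r by rewrite /r subrKC.
  have := modulusD q r; have : e1 * s <= s by rewrite ler_piMl.
  lra.
have {}H2 : modulus (H (T + eta) - H T - a * eta) <= e / 4 * modulus eta.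
  by apply: H2; lra.
have -> : G x' y' - G x y - a * T * q =
    (H (T + eta) - H T - a * eta) + a * (T * r).
  by rewrite /G ET -/T Er; ring.
have := modulusD (H (T + eta) - H T - a * eta) (a * (T * r)).
rewrite (modulusM a).
have m1 : modulus a * modulus (T * r) <= modulus a * (e1 * s) by exact: ler_wpM2l.
have m2 : modulus a * e1 * s <= e / 2 * s by exact: ler_wpM2r.
have m3 : e / 4 * modulus eta <= e / 4 * (2 * s) by apply: ler_wpM2l => //; lra.
lra.
Qed.

Let UV_first_order x y : x <= 0 ->
  exists A B : R, forall e, 0 < e -> exists2 dlt, 0 < dlt & forall x' y',
    `|x' - x| + `|y' - y| < dlt ->
    `|U x' y' - U x y - (A * (x' - x) - B * (y' - y))|
      <= e * (`|x' - x| + `|y' - y|) /\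
    `|V x' y' - V x y - (B * (x' - x) + A * (y' - y))|
      <= e * (`|x' - x| + `|y' - y|).
Proof.
move=> /(@G_first_order _ y)[[A B] h]; exists A, B => e /h[dlt dlt0 {}h].
exists dlt => // x' y' /h {}h; split.
  apply: le_trans h; apply: le_trans (Re_le_modulus _).
  by rewrite !modulusBRe /=.
apply: le_trans h; apply: le_trans (Im_le_modulus _).
by rewrite !modulusBIm /= [B * _ + _]addrC.
Qed.

Let continuous_lipschitz (f : R -> R) (y C dlt : R) : 0 < dlt ->
  (forall y', `|y' - y| < dlt -> `|f y' - f y| <= C * `|y' - y|) ->
  {for y, continuous f}.
Proof.
move=> dlt0 fC; apply/(@cvgrPdist_lt _ R^o) => e e0.
have C0 : 0 < `|C| + 1 by rewrite ltr_wpDl.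
have m0 : 0 < Num.min dlt (e / (`|C| + 1)) by rewrite lt_min dlt0 divr_gt0.
near=> t.
have : `|t - y| < Num.min dlt (e / (`|C| + 1)).
  rewrite distrC; near: t; apply/nbhs_ballP.
  by exists (Num.min dlt (e / (`|C| + 1))).
rewrite lt_min => /andP[t1 t2]; rewrite distrC (le_lt_trans (fC _ t1))//.
rewrite ltr_pdivlMr// in t2; apply: le_lt_trans t2; rewrite mulrC ler_wpM2l//.
by rewrite (le_trans (ler_norm C))// lerDl.
Unshelve. all: by end_near. Qed.

Let U_cont x a b : x <= 0 -> cont_on (U x) a b.
Proof.
move=> x0 y _; have [A [B /(_ 1 ltr01)[dlt dlt0 h]]] := UV_first_order y x0.
apply: (@continuous_lipschitz _ _ (`|B| + 1) dlt) => // y' yd.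
have [] := h x y'; rewrite subrr normr0 add0r// => + _.
rewrite mulr0 sub0r opprK mul1r => {}h.
have -> : U x y' - U x y = (U x y' - U x y + B * (y' - y)) - B * (y' - y) by ring.
by rewrite (le_trans (ler_normB _ _))// normrM mulrDl mul1r addrC lerD2l.
Qed.

Let V_cont y a b : b <= 0 -> cont_on (V ^~ y) a b.
Proof.
move=> b0 x /andP[_ xb].
have [A [B /(_ 1 ltr01)[dlt dlt0 h]]] := UV_first_order y (le_trans xb b0).
apply: (@continuous_lipschitz _ _ (`|B| + 1) dlt) => // x' xd.
have [] := h x' y; rewrite subrr normr0 addr0// => _.
rewrite mulr0 addr0 mul1r => {}h.
have -> : V x' y - V x y = (V x' y - V x y - B * (x' - x)) + B * (x' - x) by ring.
by rewrite (le_trans (ler_normD _ _))// normrM mulrDl mul1r addrC lerD2l.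
Qed.

(* The horizontal sides of the rectangle cancel because [expc] has period
   [2 pi] in [y]. *)
Let mean_const x : x <= 0 -> segint (U x) 0 (pi *+ 2) = segint (U 0) 0 (pi *+ 2).
Proof.
move=> x0; have pi0 : 0 <= (pi : R) *+ 2 by rewrite mulrn_wge0// pi_ge0.
have := @goursat R U V x 0 0 (pi *+ 2) x0 pi0.
have -> : V ^~ (pi *+ 2) = V ^~ 0 by apply/funext => z; rewrite /V /G expc_period.
rewrite subrr => /(_ _ _ _)/subr0_eq ->//.
- by move=> y /andP[_ ?]; exact: U_cont.
- by move=> y _; exact: V_cont.
- by move=> z y /andP[_ z0] _; exact: UV_first_order.
Qed.

(** In the coordinate [s] with [t = exp s], circles become vertical segments of
    length [2 pi] whose two end points are identified, so Goursat's theorem says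
    that the circular means are constant; they tend to the value at [0]. *)
Lemma Re_le_circle (M : R) :
  (forall t, modulus t = 1 -> complex.Re (H t) <= M) -> complex.Re (H 0) <= M.
Proof.
move=> HM; apply/ler_addgt0Pr => e e0.
have m0 : modulus (0 : Cplx R) <= 1 by rewrite modulus0.
have [a /(_ 1 ltr01)[dlt dlt0 Ha]] := complex_first_order (dH m0).
have a0 : 0 < modulus a + 1 by rewrite ltr_wpDl// modulus_ge0.
pose r := Num.min 1 (Num.min (dlt / 2) (e / (modulus a + 1))).
have r0 : 0 < r by rewrite !lt_min ltr01 !divr_gt0.
have r1 : r <= 1 by rewrite ge_min lexx.
have rd : r < dlt.
  have : r <= dlt / 2 by rewrite /r !ge_min lexx !orbT.
  by lra.
have ra : (modulus a + 1) * r <= e.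
  by rewrite mulrC -ler_pdivlMr// /r !ge_min lexx !orbT.
have x0 : ln r <= 0 by rewrite ln_le0.
have pi0 : 0 < (pi : R) *+ 2 by rewrite mulrn_wgt0// pi_gt0.
have cc (c : R) : cont_on (cst c) 0 (pi *+ 2) by move=> y _; exact: cvg_cst.
have lo : segint (cst (complex.Re (H 0) - e)) 0 (pi *+ 2) <= segint (U (ln r)) 0 (pi *+ 2).
  apply: le_segint => //; first exact: U_cont.
  move=> y _ /=; rewrite lerBlDr -lerBlDl.
  have mr : modulus (expc (ln r) y) = r by rewrite modulus_expc lnK.
  have := Ha (expc (ln r) y); rewrite mr add0r mul1r => /(_ rd) h.
  set z := H _ - H 0 in h.
  have zr : modulus z <= e.
    have -> : z = (z - a * expc (ln r) y) + a * expc (ln r) y by rewrite subrK.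
    have := modulusD (z - a * expc (ln r) y) (a * expc (ln r) y).
    by rewrite modulusM mr; lra.
  have := Re_le_modulus z; rewrite ler_norml modulusBRe => /andP[h1 _].
  by rewrite /U /G; lra.
have up : segint (U 0) 0 (pi *+ 2) <= segint (cst M) 0 (pi *+ 2).
  apply: le_segint => //; first exact: U_cont.
  by move=> y _; apply: HM; rewrite modulus_expc expR0.
move: lo up; rewrite mean_const// !segint_cst ?(ltW pi0)// subr0 => lo up.
by have := le_trans lo up; rewrite ler_pM2r// lerBlDr.
Qed.

End mean_value.

(** Multiplying [H] by the unit complex number that makes [H 0] a nonnegative
    real reduces the bound to one on real parts. *)
Lemma maximum_modulus (R : realType) (H : Cplx R -> Cplx R) (M : R) :
  (forall t, modulus t <= 1 -> derivable H t 1) ->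
  (forall t, modulus t = 1 -> modulus (H t) <= M) -> modulus (H 0) <= M.
Proof.
move=> dH HM.
have M0 : 0 <= M by rewrite (le_trans (modulus_ge0 _) (HM 1 _))// modulus1.
have [->//|H00] := eqVneq (modulus (H 0)) 0.
have m0 : 0 < modulus (H 0) by rewrite lt_neqAle eq_sym H00 modulus_ge0.
pose u : Cplx R := ((H 0)^* * (modulus (H 0))^-1%:C)%C.
have mu1 : modulus u = 1.
  rewrite modulusM modulus_real ger0_norm ?invr_ge0 ?modulus_ge0//.
  have -> : modulus ((H 0)^*)%C = modulus (H 0).
    by case: (H 0) => a b; rewrite /modulus /= sqrrN.
  by rewrite divff.
have -> : modulus (H 0) = complex.Re (u * H 0).
  have -> : u * H 0 = (modulus (H 0))%:C%C.
    rewrite /u mulrAC [(_)^*%C * _]mulrC -[_ * _^*%C]sqr_normc norm_modulus.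
    by rewrite -rmorphXn -rmorphM/= expr2 mulfK.
  by [].
have duH t : modulus t <= 1 -> derivable (fun t => u * H t) t 1.
  by move=> /dH; apply: derivableM; exact: derivable_cst.
apply: (Re_le_circle duH) => t /HM; apply: le_trans.
rewrite (le_trans (ler_norm _))// (le_trans (Re_le_modulus _))//.
by rewrite modulusM mu1 mul1r.
Qed.

(** * Averages over roots of unity *)

Section roots_of_unity.
Context (R : realType).
Implicit Types (t : Cplx R) (N j k : nat).

Definition unity_root N : Cplx R := expc 0 (pi *+ 2 / N%:R).

Lemma expcX (y : R) k : expc 0 y ^+ k = expc 0 (y *+ k).
Proof.
elim: k => [|k IH]; first by rewrite mulr0n expr0 expc00.
by rewrite exprS IH -expcD addr0 mulrS.
Qed.

Lemma modulus_unity_root N : modulus (unity_root N) = 1.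
Proof. by rewrite modulus_expc expR0. Qed.

Lemma unity_rootN N : (0 < N)%N -> unity_root N ^+ N = 1.
Proof.
move=> N0; rewrite expcX -[_ / _ *+ _]mulr_natr divfK ?pnatr_eq0 -?lt0n//.
by rewrite expc_period expc00.
Qed.

Lemma unit_complex_arg t : modulus t = 1 -> exists2 a, 0 <= a & t = expc 0 a.
Proof.
case: t => x y /(congr1 (fun r => r ^+ 2)).
rewrite /modulus /= sqr_sqrtr ?addr_ge0 ?sqr_ge0// expr1n => xy1.
have y2 : y ^+ 2 = 1 - x ^+ 2 by rewrite -xy1 addrC addKr.
have x1 : -1 <= x <= 1.
  by rewrite -ler_norml -(@expr_le1 _ 2)// real_normK ?num_real// -xy1 lerDl sqr_ge0.
have [y0|y0] := leP 0 y.
  exists (acos x); first exact: acos_ge0.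
  by rewrite /expc expR0 !mul1r acosK// sin_acos// -y2 sqrtr_sqr ger0_norm.
exists (pi *+ 2 - acos x).
  by rewrite subr_ge0 (le_trans (acos_lepi x1))// mulr2n lerDl pi_ge0.
rewrite -[X in expc X _]addr0 expcD expc_period expc00 mul1r.
rewrite /expc expR0 !mul1r cosN sinN acosK// sin_acos// -y2 sqrtr_sqr ltr0_norm//.
by rewrite opprK.
Qed.

Lemma unity_root_dense (e : R) : 0 < e -> exists2 N, (0 < N)%N &
  forall t, modulus t = 1 -> exists j, modulus (t - unity_root N ^+ j) < e.
Proof.
move=> e0; have [dlt dlt0 H] := expc_first_order (ltr01 : 0 < 1 :> R).
have m0 : 0 < Num.min dlt (e / 2) by rewrite lt_min dlt0 divr_gt0.
have pi2 : 0 < (pi : R) *+ 2 by rewrite mulrn_wgt0// pi_gt0.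
pose N := (Num.bound (pi *+ 2 / Num.min dlt (e / 2))).+1.
have N0 : 0 < N%:R :> R by rewrite ltr0n.
have Nm : pi *+ 2 / N%:R < Num.min dlt (e / 2).
  rewrite ltr_pdivrMr// -ltr_pdivrMl// mulrC.
  rewrite (lt_trans (archi_boundP _))// ?ltr_nat//.
  by rewrite divr_ge0 // ltW.
exists N => // t /unit_complex_arg[a a0 ->].
set d := pi *+ 2 / N%:R in Nm.
have d0 : 0 < d by rewrite divr_gt0.
exists (Num.truncn (a / d)); rewrite expcX -/d.
set j := Num.truncn _.
have /andP[ja aj] : (j%:R <= a / d < j.+1%:R).
  by apply: truncn_itv; rewrite divr_ge0 // ltW.
have {ja} : 0 <= a - d *+ j.
  by rewrite subr_ge0 -mulr_natl -ler_pdivlMr.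
have {aj} : a - d *+ j < d.
  by rewrite ltrBlDr -mulrS -mulr_natl -ltr_pdivrMr.
set k := a - _ => kd k0.
have -> : expc 0 a - expc 0 (d *+ j) = expc 0 (d *+ j) * (expc 0 k - 1).
  by rewrite mulrBr mulr1 -expcD addr0 /k subrKC.
rewrite modulusM modulus_expc expR0 mul1r.
move: Nm; rewrite lt_min => /andP[dd de].
have := H 0 k; rewrite normr0 add0r ger0_norm// mul1r.
rewrite (lt_trans kd)// => /(_ isT) {}H.
have -> : expc 0 k - 1 = (expc 0 k - 1 - (0 +i* k)%C) + (0 +i* k)%C by rewrite subrK.
apply: le_lt_trans (modulusD _ _) _.
have : modulus ((0 +i* k)%C : Cplx R) <= k.
  by rewrite (le_trans (modulus_le_ReIm _))//= normr0 add0r ger0_norm.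
lra.
Qed.

End roots_of_unity.

Section derivable_along_lines.
Variable K : numFieldType.

(** The difference quotients of the restriction to a complex line are those of
    [f] in the direction [v]. *)
Lemma derivable_line (V W : normedModType K) (f : V -> W) (z v : V) (t : K) :
  differentiable f (z + t *: v) -> derivable (fun s : K => f (z + s *: v)) t 1.
Proof.
move=> /(@diff_derivable _ _ _ _ _ v); rewrite /derivable.
rewrite (_ : (fun h => h^-1 *: ((f \o shift (z + t *: v)) (h *: v) - f (z + t *: v))) =
  (fun h => h^-1 *: (((fun s : K => f (z + s *: v)) \o shift t) (h *: 1) - f (z + t *:
    v))))//.
apply/funext => h /=; rewrite /shift /=; congr (_ *: (f _ - _)).
by rewrite [h *: 1]mulr1 scalerDl addrCA.
Qed.

Lemma derivable_scale (g : K -> K) (w t : K) :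
  derivable g (w * t) 1 -> derivable (fun s : K => g (w * s)) t 1.
Proof.
move=> /derivable1_diffP dg.
have := @derivable_line K K g 0 w t; rewrite add0r [t *: w]mulrC => /(_ dg).
by rewrite (_ : (fun s : K => _) = (fun s => g (w * s)))//; apply/funext => s;
  rewrite add0r [s *: w]mulrC.
Qed.

Lemma derivable_prod (F : nat -> K -> K) N t :
  (forall k, derivable (F k) t 1) ->
  derivable (fun s : K => \prod_(k < N) F k s) t 1.
Proof.
move=> dF; elim: N => [|N IH].
  rewrite (_ : (fun s : K => _) = cst 1); first exact: derivable_cst.
  by apply/funext => s; rewrite big_ord0.
rewrite (_ : (fun s : K => _) = (fun s : K => \prod_(k < N) F k s) * F N).
  exact: derivableM.
by apply/funext => s; rewrite big_ord_recr.
Qed.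

End derivable_along_lines.

Section discrete_jensen.
Context (R : realType).
Implicit Types (w t : Cplx R).

Lemma sum_rotation (V : zmodType) (F : nat -> V) N j :
  (forall k, F (k + N)%N = F k) ->
  \sum_(k < N) F (k + j)%N = \sum_(k < N) F k.
Proof.
move=> FN; elim: j => [|j IH]; first by under eq_bigr do rewrite addn0.
rewrite -IH; case: N FN {IH} => [|N] FN; first by rewrite !big_ord0.
rewrite big_ord_recr big_ord_recl /= addrC add0n; congr (_ + _).
  by rewrite addnS -addSn addnC FN.
by apply: eq_bigr => k _; rewrite /bump /= add1n addnS addSn.
Qed.

(** The maximum principle is applied to the product of the [N] rotations of
    [g]: its value at [0] is [g 0 ^+ N], and on the unit circle the logarithm
    of its modulus is at most the sum of [u] over a rotation of the powers of [w].
    That rotation costs at most [e] per term. *)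
Lemma discrete_jensen (g : Cplx R -> Cplx R) (u : Cplx R -> R) w N (e : R) :
  modulus w = 1 -> w ^+ N = 1 ->
  (forall t, modulus t <= 1 -> derivable g t 1) ->
  (forall t, modulus t = 1 -> modulus (g t) <= expR (u t)) ->
  (forall t, modulus t = 1 ->
    exists j, forall k, u (w ^+ k * t) <= u (w ^+ (k + j)) + e) ->
  modulus (g 0) ^+ N <= expR (\sum_(k < N) u (w ^+ k) + e *+ N).
Proof.
move=> w1 wN dg gu uw.
pose H t := \prod_(k < N) g (w ^+ k * t).
have H0 : modulus (H 0) = modulus (g 0) ^+ N.
  rewrite /H modulus_prod; under eq_bigr do rewrite mulr0.
  by rewrite prodr_const card_ord.
have mw k t : modulus (w ^+ k * t) = modulus t.
  by rewrite modulusM modulusX w1 expr1n mul1r.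
rewrite -H0; apply: maximum_modulus => t mt.
  by apply: (@derivable_prod _ (fun k t => g (w ^+ k * t))) => k;
     apply: derivable_scale; apply: dg; rewrite mw.
have [j uj] := uw _ mt.
rewrite /H modulus_prod.
apply: (@le_trans _ _ (\prod_(k < N) expR (u (w ^+ (k + j)) + e))).
  apply: ler_prod => k _; rewrite modulus_ge0 (le_trans (gu _ _)) ?mw//.
  by rewrite ler_expR uj.
rewrite -expR_sum ler_expR big_split/= sumr_const card_ord lerD2r.
rewrite (@sum_rotation _ (fun k => u (w ^+ k)))// => k.
by rewrite exprD wN mulr1.
Qed.

End discrete_jensen.

(** * Topology of the space of row vectors *)

Section topology_of_Cn.
Context (R : realType) (n : nat).
Implicit Types (x y z v : 'rV[Cplx R]_n) (e r : R).

Definition coord_close e x y := forall j, modulus (y ord0 j - x ord0 j) < e.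

(** Complex-valued radii of the norm topology are traded for real ones. *)
Lemma nbhs_coordP x (A : set 'rV[Cplx R]_n) :
  nbhs x A <-> exists2 e, 0 < e & forall y, coord_close e x y -> A y.
Proof.
split=> [/nbhs_ballP[e /= e0 xA]|[e e0 xA]].
  have [eE er0] := gt0_complexE e0.
  exists (complex.Re e) => // y xy; apply: xA; split=> // i j; rewrite ord1.
  by rewrite /ball/= distrC norm_modulus (ltc_real _ e0).
apply/nbhs_ballP; exists e%:C%C; first by rewrite /= ltcR.
move=> y [_ xy]; apply: xA => j; have := xy ord0 j.
by rewrite /ball/= distrC norm_modulus ltcR.
Qed.

Lemma nbhs_complexP (c : Cplx R) (A : set (Cplx R)) :
  nbhs c A <-> exists2 e : R, 0 < e & forall d, modulus (d - c) < e -> A d.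
Proof.
split=> [/nbhs_ballP[e /= e0 xA]|[e e0 xA]].
  have [eE er0] := gt0_complexE e0.
  exists (complex.Re e) => // y xy; apply: xA.
  by rewrite /ball/= distrC norm_modulus (ltc_real _ e0).
apply/nbhs_ballP; exists e%:C%C; first by rewrite /= ltcR.
by move=> y; rewrite /ball/= distrC norm_modulus ltcR => /xA.
Qed.

Lemma continuous_coordP (u : 'rV[Cplx R]_n -> R) x : {for x, continuous u} <->
  forall e, 0 < e -> exists2 d, 0 < d & forall y, coord_close d x y -> `|u y - u x| < e.
Proof.
split=> [/(@cvgrPdist_lt _ R^o _ (nbhs x) (nbhs_filter x)) ux e /ux|H].
  rewrite near_simpl => /nbhs_coordP[d d0 H]; exists d => // y /H.
  by rewrite distrC.
apply/(@cvgrPdist_lt _ R^o _ (nbhs x) (nbhs_filter x)) => e /H[d d0 {}H];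
  rewrite near_simpl.
by apply/nbhs_coordP; exists d => // y /H; rewrite distrC.
Qed.

Lemma modulus_continuous : continuous (@modulus R).
Proof.
move=> c; apply/(@cvgrPdist_lt _ R^o _ (nbhs c) (nbhs_filter c)) => e e0;
  rewrite near_simpl.
apply/nbhs_complexP; exists e => // d; apply: le_lt_trans.
have h1 := modulusD (c - d) d; have h2 := modulusD (d - c) c.
by move: h1 h2; rewrite !subrK (modulusB c d) ler_norml; lra.
Qed.

Lemma compact_unif_continuous (K : set 'rV[Cplx R]_n) (u : 'rV[Cplx R]_n -> R) :
  compact K -> (forall x, K x -> {for x, continuous u}) ->
  forall e, 0 < e -> exists2 d, 0 < d & forall x y, K x ->
    coord_close d x y -> `|u y - u x| < e.
Proof.
move=> /compact_near_coveringP cK uK e e0.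
pose P (d : R) x := forall y, coord_close d x y -> `|u y - u x| < e.
have : \forall d \near (0 : R)^'+, K `<=` P d.
  apply: cK => x Kx.
  have e20 : 0 < e / 2 by lra.
  have /continuous_coordP/(_ _ e20)[d d0 H] := uK _ Kx.
  exists ([set y | coord_close (d / 2) x y], [set q | q < d / 2]).
    split=> /=.
      by apply/nbhs_coordP; exists (d / 2) => //; lra.
    by apply: nbhs_right_lt; lra.
  move=> [x' d'] /= [xx' d'd] y x'y.
  have h1 := H _ (_ : coord_close d x x').
  have : coord_close d x y.
    move=> j; have := modulusD (y ord0 j - x' ord0 j) (x' ord0 j - x ord0 j).
    by rewrite addrA subrK; have := xx' j; have := x'y j; lra.
  move=> /H; have /h1 : coord_close d x x' by move=> j; have := xx' j; lra.
  by rewrite !ltr_norml => /andP[? ?] /andP[? ?]; lra.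
move=> /nbhs_ballP[d /= d0 H]; exists (d / 2) => [|x y Kx]; first lra.
apply: H => //=; last by lra.
by rewrite /ball/= sub0r normrN gtr0_norm; lra.
Qed.

Lemma enorm_ge0 x : 0 <= enorm x. Proof. exact: sqrtr_ge0. Qed.

Lemma sqr_enorm x : enorm x ^+ 2 = \sum_(j < n) modulus (x ord0 j) ^+ 2.
Proof. by rewrite sqr_sqrtr// sumr_ge0// => j _; rewrite sqr_ge0. Qed.

Lemma enormZ (c : Cplx R) x : enorm (c *: x) = modulus c * enorm x.
Proof.
rewrite /enorm -[modulus c]ger0_norm ?modulus_ge0// -sqrtr_sqr -sqrtrM ?sqr_ge0//.
congr Num.sqrt; rewrite mulr_sumr; apply: eq_bigr => j _.
by rewrite mxE modulusM exprMn.
Qed.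

Lemma modulus_le_enorm x j : modulus (x ord0 j) <= enorm x.
Proof.
rewrite -[modulus _]ger0_norm ?modulus_ge0// -sqrtr_sqr ler_wsqrtr//.
by rewrite (bigD1 j)//= lerDl sumr_ge0// => k _; rewrite sqr_ge0.
Qed.

Lemma enorm_continuous z : continuous (fun x => enorm (x - z)).
Proof.
move=> x; apply: (@continuous_comp _ _ _ (fun x => \sum_(j < n) modulus ((x - z) ord0
  j) ^+ 2) (@Num.sqrt R)); last exact: sqrt_continuous.
elim: (index_enum _) => [|j l IH].
  rewrite (_ : (fun y : 'rV[Cplx R]_n => _) = cst (0 : R)); first exact: cst_continuous.
  by apply/funext => y; rewrite big_nil.
have cj : continuous (fun y : 'rV[Cplx R]_n => modulus ((y - z) ord0 j) ^+ 2).
  move=> y.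
  apply: (@continuous_comp _ _ _ (fun x : 'rV_n => modulus ((x - z) ord0 j)) (fun a : R
    => a ^+ 2)); last exact: exprn_continuous.
  apply/continuous_coordP => e e0; exists e => // y' /(_ j); apply: le_lt_trans.
  have -> : y' ord0 j - y ord0 j = (y' - z) ord0 j - (y - z) ord0 j.
    by rewrite !mxE; ring.
  move: ((y' - z) ord0 j) ((y - z) ord0 j) => a b.
  have h1 := modulusD (a - b) b; have h2 := modulusD (b - a) a.
  by move: h1 h2; rewrite !subrK (modulusB b a) ler_norml; lra.
rewrite (_ : (fun y : 'rV[Cplx R]_n => _) = (fun y => modulus ((y - z) ord0 j) ^+ 2) \+
    (fun y => \sum_(k <- l) modulus ((y - z) ord0 k) ^+ 2)); last first.
  by apply/funext => y; rewrite big_cons.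
exact: (@continuousD _ R^o _ _ _ x (cj x) IH).
Qed.

Definition closed_eball z r := [set x | enorm (x - z) <= r].

Lemma closed_closed_eball z r : closed (closed_eball z r).
Proof.
have -> : closed_eball z r = (fun x => enorm (x - z)) @^-1` [set a | a <= r] by [].
by apply: closed_comp; [move=> ? _; exact: enorm_continuous|exact: closed_le].
Qed.

Lemma compact_complex_square (c : Cplx R) r :
  compact [set d : Cplx R | `|complex.Re d - complex.Re c| <= r /\
                            `|complex.Im d - complex.Im c| <= r].
Proof.
pose toC (p : R * R) : Cplx R := (p.1 +i* p.2)%C.
set A := [set d | _].
have -> : A = toC @` (`[complex.Re c - r, complex.Re c + r] `*` `[complex.Im c - r,
  complex.Im c + r]).
  apply/seteqP; split=> [[a b] /= [ha hb]|_ [[a b] /= [ha hb] <-] /=].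
    exists (a, b) => //=; rewrite !in_itv/=; move: ha hb; rewrite !ler_distl.
    by move=> /andP[-> ->] /andP[-> ->].
  by move: ha hb; rewrite /A /toC /= !in_itv/= !ler_distl => -> ->.
apply: continuous_compact; last by apply: compact_setX; exact: segment_compact.
apply: continuous_subspaceT => -[a b] B /nbhs_complexP[e e0 H].
rewrite nbhs_simpl /=; apply/nbhs_ballP; exists (e / 2); first by rewrite /= ; lra.
move=> [a' b'] [/= ha hb]; apply: H.
apply: le_lt_trans (modulus_le_ReIm _) _ => /=.
by move: ha hb; rewrite /ball/= (distrC a) (distrC b); lra.
Qed.

Lemma compact_closed_eball z r : compact (closed_eball z r).
Proof.
pose sq (j : 'I_n) := [set d : Cplx R |
  `|complex.Re d - complex.Re (z ord0 j)| <= r /\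
  `|complex.Im d - complex.Im (z ord0 j)| <= r].
apply: (@subclosed_compact _ _ [set x : 'rV_n | forall j, sq j (x ord0 j)]).
- exact: closed_closed_eball.
- apply: (@rV_compact _ _ sq) => j; exact: compact_complex_square.
- move=> x /= xz j; have h := le_trans (modulus_le_enorm (x - z) j) xz.
  rewrite !mxE in h; rewrite /sq /= -modulusBRe -modulusBIm.
  by split; apply: le_trans h; [exact: Re_le_modulus|exact: Im_le_modulus].
Qed.

End topology_of_Cn.

(** * Rotation averages of the logarithm of the modulus *)

Section rotation_mean.
Context (R : realType) (n : nat).
Implicit Types (f : 'rV[Cplx R]_n -> Cplx R) (x z : 'rV[Cplx R]_n).

(** [ln |f|] truncated from below, so that it is finite and continuous. *)
Definition log_trunc f (eps : R) x : R := ln (Num.max (modulus (f x)) eps).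

Lemma log_trunc_continuous f eps x : 0 < eps -> {for x, continuous f} ->
  {for x, continuous (log_trunc f eps)}.
Proof.
move=> eps0 fx.
apply: (@continuous_comp _ _ _ (fun x => Num.max (modulus (f x)) eps) (@ln R)).
  apply: (@continuous_comp _ _ _ (fun x => modulus (f x)) (fun a : R => Num.max a eps)).
    by apply: (@continuous_comp _ _ _ f (@modulus R)) => //; exact: modulus_continuous.
  by apply: continuous_max; [exact: cvg_id|exact: cvg_cst].
by apply: continuous_ln; rewrite lt_max eps0 orbT.
Qed.

Lemma modulus_le_log_trunc f eps x : 0 < eps ->
  modulus (f x) <= expR (log_trunc f eps x).
Proof.
move=> eps0; rewrite /log_trunc lnK; first by rewrite le_max lexx.
by rewrite posrE lt_max eps0 orbT.
Qed.

(** By uniform continuity of [log_trunc f eps] on the closed ball, rotating the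
    [N] points [z + w^k (x - z)] by any further angle changes the average by at
    most [e] once [N] is large; [discrete_jensen] applies on the line through
    [z] and [x], with [N] and [w] that do not depend on [x]. *)
Lemma log_le_rotation_mean f z (r eps e : R) : 0 <= r -> 0 < eps -> 0 < e ->
  (forall x, closed_eball z r x -> differentiable f x) -> f z != 0 ->
  exists N w, [/\ (0 < N)%N, modulus w = 1 & forall x, closed_eball z r x ->
    ln (modulus (f z)) *+ N <=
      \sum_(k < N) log_trunc f eps (z + w ^+ k *: (x - z)) + e *+ N].
Proof.
move=> r0 eps0 e0 df fz.
have uK x : closed_eball z r x -> {for x, continuous (log_trunc f eps)}.
  by move=> /df /differentiable_continuous; exact: log_trunc_continuous.
have [d d0 uU] := compact_unif_continuous (@compact_closed_eball _ _ z r) uK e0.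
have r1 : 0 < r + 1 by rewrite ltr_wpDl.
have [N N0 wd] := @unity_root_dense R (d / (r + 1)) (divr_gt0 d0 r1).
exists N, (unity_root R N); split=> //; first exact: modulus_unity_root.
move=> x Kx; set w := unity_root R N in wd *.
pose v := x - z.
have in_ball t : modulus t <= 1 -> closed_eball z r (z + t *: v).
  move=> t1; rewrite /closed_eball /= addrC addrA addNr add0r enormZ.
  by rewrite (le_trans _ Kx)// ler_piMl// enorm_ge0.
have mw k : modulus (w ^+ k) = 1 by rewrite modulusX modulus_unity_root expr1n.
have fz0 : 0 < modulus (f z).
  rewrite lt_neqAle modulus_ge0 andbT eq_sym; apply: contra fz => /eqP.
  by move=> /modulus_eq0 ->.
have := @discrete_jensen R (fun t => f (z + t *: v))
  (fun t => log_trunc f eps (z + t *: v)) w N e (modulus_unity_root R N)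
  (unity_rootN R N0).
rewrite scale0r addr0 => H.
have {}H : modulus (f z) ^+ N <=
    expR (\sum_(k < N) log_trunc f eps (z + w ^+ k *: v) + e *+ N).
  apply: H.
  - by move=> t t1; apply: derivable_line; apply: df; exact: in_ball.
  - by move=> t _; exact: modulus_le_log_trunc.
  move=> t t1; have [j tj] := wd _ t1; exists j => k.
  have m1 : modulus (w ^+ k * t) <= 1 by rewrite modulusM mw t1 mul1r.
  have m2 : modulus (w ^+ (k + j)) <= 1 by rewrite mw.
  suff : `|log_trunc f eps (z + (w ^+ k * t) *: v) -
           log_trunc f eps (z + w ^+ (k + j) *: v)| < e.
    by move=> /ltW; rewrite -lerBlDl; apply: le_trans; exact: ler_norm.
  apply: uU; first exact: in_ball.
  move=> i; rewrite !mxE opprD addrACA subrr add0r -mulrBl exprD -mulrBr.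
  rewrite modulusM modulusM mw mul1r.
  apply: (@le_lt_trans _ _ (modulus (t - w ^+ j) * (r + 1))).
    rewrite ler_wpM2l ?modulus_ge0//; have := modulus_le_enorm v i.
    rewrite !mxE => h; rewrite (le_trans h)// (le_trans Kx)// lerDl.
    exact: ler01.
  by rewrite -ltr_pdivlMr.
by rewrite -lnXn// -ler_expR lnK// posrE exprn_gt0.
Qed.

End rotation_mean.

(** * Measure preserving maps of the plane *)

Section measure_preserving.
Local Open Scope ereal_scope.
Context d (T : measurableType d) (R : realType).
Variable mu : {measure set T -> \bar R}.
Implicit Types phi psi : T -> T.

Definition preserves phi := measurable_fun setT phi /\
  forall A, measurable A -> mu (phi @^-1` A) = mu A.

Lemma preserves_id : preserves id.
Proof. by split => //; exact: measurable_id. Qed.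

Lemma preserves_comp phi psi : preserves phi -> preserves psi ->
  preserves (phi \o psi).
Proof.
move=> [mphi phiE] [mpsi psiE]; split; first exact: measurableT_comp.
move=> A mA; rewrite comp_preimage psiE ?phiE//.
by rewrite -[X in measurable X]setTI; exact: mphi.
Qed.

Lemma preserves_integral phi D (f : T -> \bar R) : preserves phi ->
  measurable D -> measurable_fun D f -> (forall x, D x -> 0 <= f x) ->
  \int[mu]_(x in phi @^-1` D) f (phi x) = \int[mu]_(x in D) f x.
Proof.
move=> [mphi phiE] mD mf f0.
rewrite -(@ge0_integral_pushforward _ _ _ _ _ phi mphi mu D f mD mf); last first.
  by move=> x /set_mem; exact: f0.
by apply: eq_measure_integral => A mA _; exact: phiE.
Qed.

End measure_preserving.

Section product_preserving.
Local Open Scope ereal_scope.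
Context d1 d2 (T1 : measurableType d1) (T2 : measurableType d2) (R : realType).
Variables (m1 : {measure set T1 -> \bar R}).
Variables (m2 : {sigma_finite_measure set T2 -> \bar R}).

(** The sections of the preimage of [A] over [t] are the preimages under
    [rho t] of the sections of [A] over [S t]. *)
Lemma preserves_skew (S : T1 -> T1) (rho : T1 -> T2 -> T2) :
  preserves m1 S -> (forall t, preserves m2 (rho t)) ->
  measurable_fun setT (fun p : T1 * T2 => rho p.1 p.2) ->
  preserves (m1 \x m2) (fun p => (S p.1, rho p.1 p.2)).
Proof.
move=> pS prho mrho; have [mS _] := pS.
have mphi : measurable_fun setT (fun p : T1 * T2 => (S p.1, rho p.1 p.2)).
  apply/measurable_fun_pairP; split; last exact: mrho.
  exact: (measurableT_comp mS measurable_fst).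
split=> // A mA; transitivity (\int[m1]_t (m2 \o xsection A) (S t)); last first.
  rewrite -[setT in LHS](preimage_setT S).
  apply: (preserves_integral pS measurableT) => //.
  exact: measurable_fun_xsection.
apply: eq_integral => t _ /=.
rewrite -((prho t).2 (xsection A (S t)) (measurable_xsection (S t) mA)).
by congr (m2 _); apply/seteqP; split => x; rewrite /xsection /= !inE.
Qed.

End product_preserving.

(* A point of the plane is stored as [(y, x)]: in an iterated product the
   coordinate added last comes first in the tuple. *)
Section planar_maps.
Context (R : realType).
Local Notation leb := (@lebesgue_measure R).
Local Notation T := (measurableTypeR R).

Lemma preserves_shift (a : R) : preserves leb (fun x : T => (x + a : T)).
Proof.
have msh : measurable_fun setT (fun x : T => (x + a : T)).
  by apply: measurable_funD; [exact: measurable_id|exact: measurable_cst].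
split=> // A mA.
rewrite -[LHS]/(pushforward leb (fun x : T => (x + a : T)) A).
apply/esym; apply: (@lebesgue_measure_unique R
  (measure_function_pushforward__canonical__measure_function_Measure leb msh)) => //.
move=> _ [[u v] _ <-] /=; rewrite /pushforward.
rewrite (_ : _ @^-1` _ = `]u - a, v - a]%classic); last first.
  by apply/seteqP; split => x /=; rewrite !in_itv/= ltrBlDr lerBrDr.
by rewrite !lebesgue_measure_itv/= !lte_fin ltrD2r -!EFinD opprD opprK addrACA addNr addr0.
Qed.

Lemma preserves_swap :
  preserves (leb \x leb)%E (fun p : T * T => (p.2, p.1)).
Proof.
split; first by apply/measurable_fun_pairP; split;
  [exact: measurable_snd|exact: measurable_fst].
move=> A mA; have mA' : measurable ((fun p : T * T => (p.2, p.1)) @^-1` A).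
  rewrite -[X in measurable X]setTI.
  by apply: measurable_fun_pair mA.
transitivity ((leb \x^ leb)%E A); last first.
  apply/esym/(@product_measure_unique _ _ _ _ _ leb leb) => // B C mB mC.
  exact: product_measure2E.
rewrite /product_measure1 /product_measure2; apply: eq_integral => x _ /=.
by congr (leb _); apply/seteqP; split => y; rewrite /xsection /ysection /= !inE.
Qed.

Lemma preserves_shear (a : R) :
  preserves (leb \x leb)%E (fun p : T * T => (p.1, p.2 + a * p.1 : T)).
Proof.
apply: (@preserves_skew _ _ _ _ _ leb leb id (fun y x => x + a * y)%R).
- exact: preserves_id.
- by move=> t; exact: preserves_shift.
apply: measurable_funD; first exact: measurable_snd.
by apply: measurable_funM; [exact: measurable_cst|exact: measurable_fst].
Qed.

Lemma preserves_shear_swapped (a : R) :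
  preserves (leb \x leb)%E (fun p : T * T => (p.1 + a * p.2 : T, p.2)).
Proof.
apply: (preserves_comp preserves_swap (preserves_comp (preserves_shear a) preserves_swap)).
Qed.

(** A rotation with nonzero sine is a product of three shears, and the half turn
    is the square of the quarter turn. *)
Lemma preserves_rotation (c s : R) : c ^+ 2 + s ^+ 2 = 1 ->
  preserves (leb \x leb)%E
    (fun p : T * T => (s * p.2 + c * p.1 : T, c * p.2 - s * p.1 : T)).
Proof.
have nondeg c' s' : s' != 0 -> c' ^+ 2 + s' ^+ 2 = 1 -> preserves (leb \x leb)%E
    (fun p : T * T => (s' * p.2 + c' * p.1 : T, c' * p.2 - s' * p.1 : T)).
  move=> s0 cs.
  (* [a] is minus the tangent of half the angle. *)
  pose a := (c' - 1) / s'.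
  have E : c' ^+ 2 = 1 - s' ^+ 2 by lra.
  have := preserves_comp (preserves_shear a)
    (preserves_comp (preserves_shear_swapped s') (preserves_shear a)).
  rewrite (_ : _ \o _ = (fun p : T * T =>
    (s' * p.2 + c' * p.1 : T, c' * p.2 - s' * p.1 : T)))//.
  apply/funext => -[y x] /=; congr (_, _); first by rewrite /a; field.
  apply: (@mulfI _ s') => //; rewrite /a.
  transitivity (s' * c' * x + (c' ^+ 2 - 1) * y); first by field.
  by rewrite E; ring.
move=> cs; have [s0|] := eqVneq s 0; last by move=> s0; exact: nondeg.
have /eqP : c ^+ 2 = 1 by rewrite -cs s0 expr0n addr0.
rewrite sqrf_eq1 s0 => /orP[] /eqP ->.
  rewrite (_ : (fun _ => _) = id); first exact: preserves_id.
  by apply/funext => -[y x] /=; rewrite !mul0r !mul1r add0r subr0.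
have q : (0 : R) ^+ 2 + 1 ^+ 2 = 1 by rewrite expr0n expr1n add0r.
have := preserves_comp (nondeg _ _ (oner_neq0 _) q) (nondeg _ _ (oner_neq0 _) q).
rewrite (_ : _ \o _ = (fun p : T * T => (0 * p.2 + -1 * p.1 : T, -1 * p.2 - 0 * p.1 :
  T)))//.
by apply/funext => -[y x] /=; congr (_, _); ring.
Qed.

Lemma preserves_planar_isometry (c s a b : R) : c ^+ 2 + s ^+ 2 = 1 ->
  preserves (leb \x leb)%E (fun p : T * T =>
    (s * p.2 + c * p.1 + b : T, c * p.2 - s * p.1 + a : T)).
Proof.
move=> cs; apply: (preserves_comp _ (preserves_rotation cs)
  : preserves _ ((fun p : T * T => (p.1 + b : T, p.2 + a : T)) \o _)).
apply: (@preserves_skew _ _ _ _ _ leb leb (fun y => y + b)%R (fun _ x => x + a)%R).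
- exact: preserves_shift.
- by move=> _; exact: preserves_shift.
by apply: measurable_funD; [exact: measurable_snd|exact: measurable_cst].
Qed.

End planar_maps.

(** * Powers of a sigma-finite measure *)

Section product_power_theory.
Local Open Scope ereal_scope.
Context d (T : measurableType d) (R : realType).
Variable mu : {sigma_finite_measure set T -> \bar R}.

Definition tuncons n (t : n.+1.-tuple T) : n.-tuple T * T :=
  ([tuple of behead t], thead t).

Lemma measurable_tuncons n : measurable_fun setT (@tuncons n).
Proof.
apply/measurable_fun_pairP; split; first exact: measurable_behead.
exact: measurable_tnth.
Qed.

Lemma tconsK n : cancel (@tcons _ T n) (@tuncons n).
Proof.
by move=> [t x]; rewrite /tuncons /tcons theadE; congr (_, _); exact: val_inj.
Qed.

Lemma product_power_sigma_finite n : sigma_finite setT (product_power mu n).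
Proof.
elim: n => [|n IH].
  exists (fun=> setT); first by rewrite bigcup_const//; exists 0%N.
  by move=> _; split => //=; rewrite diracT ltry.
have /sigma_finiteP[F [TF ndF Foo]] := IH.
have /sigma_finiteP[G [TG ndG Goo]] := sigma_finiteT mu.
exists (fun k => @tuncons n @^-1` (F k `*` G k)).
  rewrite -preimage_bigcup (_ : \bigcup_k _ = setT) ?preimage_setT//.
  rewrite -setXTT TF TG predeqE => -[x y]; split.
    by move=> [k _ []/= ? ?]; split; exists k.
  move=> [/= [k _ Fkx] [l _ Gly]]; exists (maxn k l) => //; split.
  - by move: x Fkx; exact/subsetPset/ndF/leq_maxl.
  - by move: y Gly; exact/subsetPset/ndG/leq_maxr.
move=> k; have [mF Fk] := Foo k; have [mG Gk] := Goo k.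
have mFG : measurable (F k `*` G k) by exact: measurableX.
split.
  by rewrite -[X in measurable X]setTI; exact: measurable_tuncons.
rewrite /= /product_succ /pushforward -comp_preimage.
rewrite (_ : _ \o _ = id); last by apply/funext => p /=; rewrite tconsK.
by rewrite preimage_id product_measure1E// lte_mul_pinfty// ge0_fin_numE.
Qed.

(** The function underlying [product_power], named so that the sigma-finite
    structure has a head symbol to be attached to. *)
Definition power_measure (n : nat) : set (n.-tuple T) -> \bar R :=
  product_power mu n.
Arguments power_measure n _ : clear implicits.

HB.instance Definition _ n := Measure.copy (power_measure n) (product_power mu n).
HB.instance Definition _ n := Measure_isSigmaFinite.Build _ _ _ (power_measure n)
  (product_power_sigma_finite n).

(** The product [mu \x mu] under a name that carries its sigma-finite structure. *)
Definition square_measure : set (T * T) -> \bar R := mu \x mu.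

HB.instance Definition _ := Measure.copy square_measure (mu \x mu).

Lemma square_measure_sigma_finite : sigma_finite setT square_measure.
Proof.
have /sigma_finiteP[F [TF ndF Foo]] := sigma_finiteT mu.
exists (fun k => F k `*` F k).
  rewrite -setXTT TF predeqE => -[x y]; split.
    move=> [/= [k _ Fkx] [l _ Fly]]; exists (maxn k l) => //; split.
    - by move: x Fkx; exact/subsetPset/ndF/leq_maxl.
    - by move: y Fly; exact/subsetPset/ndF/leq_maxr.
  by move=> [k _ []/= ? ?]; split; exists k.
move=> k; have [mF Fk] := Foo k; split; first exact: measurableX.
by rewrite /square_measure product_measure1E// lte_mul_pinfty// ge0_fin_numE.
Qed.

HB.instance Definition _ := Measure_isSigmaFinite.Build _ _ _ square_measure
  square_measure_sigma_finite.

Definition tcons2 n (p : n.-tuple T * (T * T)) : n.+2.-tuple T :=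
  tcons (tcons (p.1, p.2.1), p.2.2).

Lemma measurable_tcons2 n : measurable_fun setT (@tcons2 n).
Proof.
have m1 : measurable_fun setT (fun p : n.-tuple T * (T * T) => tcons (p.1, p.2.1)).
  apply: (measurableT_comp (@measurable_tcons _ T n)).
  apply/measurable_fun_pairP; split; first exact: measurable_fst.
  exact: (measurableT_comp measurable_fst measurable_snd).
apply: (measurableT_comp (@measurable_tcons _ T n.+1)).
apply/measurable_fun_pairP; split; first exact: m1.
exact: (measurableT_comp measurable_snd measurable_snd).
Qed.

(** The two entries added last can be integrated together, as a planar
    integral: this is how one complex coordinate is split off. *)
Lemma power_measureSS n A : measurable A ->
  power_measure n.+2 A = (power_measure n \x square_measure) (@tcons2 n @^-1` A).
Proof.
move=> mA; rewrite /power_measure /= {1}/product_succ /pushforward.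
have mA1 : measurable (@tcons _ T n.+1 @^-1` A).
  by rewrite -[X in measurable X]setTI; exact: measurable_tcons.
have mF := @measurable_fun_xsection _ _ _ _ _ mu _ mA1.
transitivity (\int[power_measure n \x mu]_p
    mu (xsection (@tcons _ T n.+1 @^-1` A) (tcons p))).
  have := @ge0_integral_pushforward _ _ _ _ _ _ (@measurable_tcons _ T n)
    (power_measure n \x mu) setT (mu \o xsection (@tcons _ T n.+1 @^-1` A))
    measurableT mF (fun _ _ => measure_ge0 _ _).
  by rewrite preimage_setT => <-.
rewrite fubini_tonelli1; [|exact: (measurableT_comp mF (@measurable_tcons _ T n))|by
  move=> p; exact: measure_ge0].
apply: eq_integral => t _; apply: eq_integral => y _ /=.
by rewrite !xsectionE.
Qed.

Lemma preserves_tcons2 n (S : n.-tuple T -> n.-tuple T) (rho : T * T -> T * T)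
    (Psi : n.+2.-tuple T -> n.+2.-tuple T) :
  measurable_fun setT Psi ->
  (forall t p, Psi (tcons2 (t, p)) = tcons2 (S t, rho p)) ->
  preserves (power_measure n) S -> preserves square_measure rho ->
  preserves (power_measure n.+2) Psi.
Proof.
move=> mPsi PsiE pS prho; split=> // A mA.
have mPA : measurable (Psi @^-1` A) by rewrite -[X in measurable X]setTI; exact: mPsi.
have mA2 : measurable (@tcons2 n @^-1` A).
  by rewrite -[X in measurable X]setTI; exact: measurable_tcons2.
transitivity ((power_measure n \x square_measure) (@tcons2 n @^-1` (Psi @^-1` A))).
  exact: power_measureSS.
transitivity ((power_measure n \x square_measure) (@tcons2 n @^-1` A)); last first.
  by apply/esym; exact: power_measureSS.
have prod_preserves : preserves (power_measure n \x square_measure) (fun p => (S p.1,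
  rho p.2)).
  apply: (@preserves_skew _ _ _ _ _ (power_measure n) square_measure S (fun _ => rho))
    => //.
  exact: (measurableT_comp prho.1 measurable_snd).
rewrite -(prod_preserves.2 _ mA2).
by congr (_ _); apply/seteqP; split => -[t p] /=; rewrite PsiE.
Qed.

End product_power_theory.
Arguments power_measure {d T R} mu n _.

(** * Invariance of Lebesgue measure *)

Section tuples_of_reals.
Context (R : realType).
Local Notation T := (measurableTypeR R).
Local Notation leb := (@lebesgue_measure R).

Lemma measurable_nth_tuple m k :
  measurable_fun setT (fun t : m.-tuple T => (nth 0 (t : seq R) k : T)).
Proof.
have [km|mk] := ltnP k m.
  rewrite (_ : (fun t => _) = (fun t : m.-tuple T => tnth t (Ordinal km))).
    exact: measurable_tnth.
  by apply/funext => t; rewrite (tnth_nth 0).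
rewrite (_ : (fun t => _) = cst (0 : T)); first exact: measurable_cst.
by apply/funext => t; rewrite nth_default// size_tuple.
Qed.

(** A set that is open for the sup distance is the union of the boxes with
    rational centre and radius [1 / (k + 1)] that it contains. *)
Lemma measurable_open_tuple m (P : set (m.-tuple T)) :
  (forall t, P t -> exists2 e : R, 0 < e & forall t' : m.-tuple T,
    (forall i, `|nth 0 (t' : seq R) i - nth 0 (t : seq R) i| < e) -> P t') ->
  measurable P.
Proof.
move=> openP.
pose box (q : m.-tuple rat) (k : nat) : set (m.-tuple T) := [set t : m.-tuple T |
  forall i, `|nth 0 (t : seq R) i - ratr (nth 0 q i)| < k.+1%:R^-1].
have mbox q k : measurable (box q k).
  have -> : box q k = \bigcap_i [set t : m.-tuple T |
      `|nth 0 (t : seq R) i - ratr (nth 0 q i)| < k.+1%:R^-1].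
    by apply/seteqP; split => t /= H i; [move=> _|]; exact: H.
  apply: bigcapT_measurable => i.
  have mf : measurable_fun setT (fun t : m.-tuple T => `|nth 0 (t : seq R) i - ratr
    (nth 0 q i)| : T).
    apply: measurableT_comp => //; apply: measurable_funB;
      first exact: measurable_nth_tuple.
    exact: measurable_cst.
  have := mf measurableT _ (measurable_itv `]-oo, k.+1%:R^-1[); rewrite setTI.
  by congr (measurable _); apply/seteqP; split => t /=; rewrite in_itv.
pose F (j : nat) := if unpickle j is Some qk then
  (if `[< box qk.1 qk.2 `<=` P >] then box qk.1 qk.2 else set0) else set0.
have -> : P = \bigcup_j F j.
  apply/seteqP; split => [t Pt|t [j _]]; last first.
    rewrite /F; case: unpickle => // -[q k]; case: asboolP => // + tq.
    exact.
  have [e e0 H] := openP _ Pt.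
  have [k ke] : exists k : nat, k.+1%:R^-1 < e / 2 :> R.
    exists (Num.bound (2 / e)); rewrite invf_plt ?posrE ?divr_gt0// invf_div.
    by rewrite (lt_trans (archi_boundP _))// ?ltr_nat// divr_ge0// ltW.
  have k0 : 0 < k.+1%:R^-1 :> R by rewrite invr_gt0 ltr0n.
  have near_rat (i : 'I_m) : exists q : rat, `|tnth t i - ratr q| < k.+1%:R^-1.
    have := @rat_in_itvoo R (tnth t i - k.+1%:R^-1) (tnth t i + k.+1%:R^-1).
    case; first by rewrite ltrBlDr -addrA ltrDl addr_gt0.
    move=> q; rewrite in_itv/= => /andP[q1 q2]; exists q.
    by rewrite ltr_distlC q1 q2.
  have [q qP] := fin_all_exists near_rat.
  pose qt := [tuple q i | i < m].
  have tq : box qt k t.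
    move=> i; have [im|mi] := ltnP i m; last first.
      by rewrite !nth_default ?size_tuple// raddf0 subrr normr0.
    have := qP (Ordinal im); rewrite (tnth_nth 0) /=.
    by have := tnth_mktuple q (Ordinal im); rewrite (tnth_nth 0) /= -/qt => ->.
  exists (pickle (qt, k)) => //; rewrite /F pickleK /=.
  case: asboolP => // -[] t' t'q; apply: H => i.
  apply: le_lt_trans (ler_distD (ratr (nth 0 qt i)) _ _) _.
  rewrite [X in _ + X]distrC; apply: lt_le_trans (ltrD (t'q i) (tq i)) _.
  by rewrite [leRHS]splitr lerD// ltW.
apply: bigcupT_measurable => j; rewrite /F; case: unpickle => // qk.
by case: ifP => // _; exact: mbox.
Qed.

(** On each pair of entries [2 j], [2 j + 1] this is the planar map
    [zeta |-> (c + i s) zeta + (b (2 j) + i b (2 j + 1))]. *)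
Definition rotate_tuple (c s : R) (b : nat -> R) m (t : m.-tuple T) : m.-tuple T :=
  [tuple of mkseq (fun i => if odd i
    then s * nth 0 (t : seq R) i.-1 + c * nth 0 (t : seq R) i + b i
    else c * nth 0 (t : seq R) i - s * nth 0 (t : seq R) i.+1 + b i) m].

Lemma measurable_rotate_tuple c s b m : measurable_fun setT (@rotate_tuple c s b m).
Proof.
apply/measurable_fun_tnthP => i.
rewrite (_ : _ \o _ = (fun t : m.-tuple T => if odd i
    then s * nth 0 (t : seq R) i.-1 + c * nth 0 (t : seq R) i + b i
    else c * nth 0 (t : seq R) i - s * nth 0 (t : seq R) i.+1 + b i)); last first.
  by apply/funext => t /=; rewrite (tnth_nth 0) /= nth_mkseq.
case: (odd i); apply: measurable_funD; try exact: measurable_cst.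
  apply: measurable_funD; apply: measurable_funM; try exact: measurable_cst;
    exact: measurable_nth_tuple.
apply: measurable_funB; apply: measurable_funM; try exact: measurable_cst;
  exact: measurable_nth_tuple.
Qed.

Lemma rotate_tuple_tcons2 c s b m (t : m.-tuple T) (p : T * T) :
  rotate_tuple c s b (tcons2 (t, p)) =
  tcons2 (rotate_tuple c s (fun i => b i.+2) t,
          (s * p.2 + c * p.1 + b 1%N : T, c * p.2 - s * p.1 + b 0%N : T)).
Proof.
apply: val_inj => /=; rewrite /mkseq /=; congr [:: _, _ & _].
rewrite -[2%N]addn0 iotaDl -map_comp; apply: eq_map => -[|i] //=.
by rewrite negbK.
Qed.

Lemma preserves_rotate_tuple c s b n : c ^+ 2 + s ^+ 2 = 1 ->
  preserves (power_measure leb n.*2) (@rotate_tuple c s b n.*2).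
Proof.
move=> cs; elim: n b => [|n IH] b.
  rewrite (_ : @rotate_tuple c s b _ = id); first exact: preserves_id.
  by apply/funext => t; rewrite [LHS]tuple0 [RHS]tuple0.
rewrite doubleS; apply: (@preserves_tcons2 _ _ _ leb n.*2 (@rotate_tuple c s (fun i =>
  b i.+2) n.*2)
  (fun p => (s * p.2 + c * p.1 + b 1%N : T, c * p.2 - s * p.1 + b 0%N : T))).
- exact: measurable_rotate_tuple.
- by move=> t p; exact: rotate_tuple_tcons2.
- exact: IH.
- exact: preserves_planar_isometry.
Qed.

End tuples_of_reals.

Section lambda_theory.
Context (R : realType) (n : nat).
Local Notation T := (measurableTypeR R).
Local Notation leb := (@lebesgue_measure R).
Implicit Types (A U : set 'rV[Cplx R]_n) (v x z : 'rV[Cplx R]_n) (w : Cplx R).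

(** Sets with Borel preimage under the coordinates satisfy the Caratheodory
    criterion, since the outer measure is computed on preimages. *)
Lemma measurable_Cn A : measurable (@Cn_of_reals R n @^-1` A) ->
  measurable (A : set (Cn R n)).
Proof.
move=> /caratheodory_measurable_mu_ext mA.
suff : caratheodory_measurable (@lebesgue_outer R n) A by [].
by move=> X; rewrite /lebesgue_outer !preimage_setI preimage_setC; exact: mA.
Qed.

Lemma lambdaE A : measurable (@Cn_of_reals R n @^-1` A) ->
  lambda A = power_measure leb n.*2 (@Cn_of_reals R n @^-1` A).
Proof. exact: measurable_mu_extE. Qed.

Lemma measurable_Cn_of_reals_open U : open U ->
  measurable (@Cn_of_reals R n @^-1` U).
Proof.
move=> oU; apply: measurable_open_tuple => t Ut.
have /nbhs_coordP[e e0 H] : nbhs (Cn_of_reals t) U by exact: open_nbhs_nbhs.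
exists (e / 2) => [|t' tt']; first by lra.
apply: H => j; rewrite !mxE; apply: le_lt_trans (modulus_le_ReIm _) _ => /=.
by have := tt' j.*2; have := tt' j.*2.+1; lra.
Qed.

Lemma measurable_Cn_open U : open U -> measurable (U : set (Cn R n)).
Proof. by move=> /measurable_Cn_of_reals_open/measurable_Cn. Qed.

Lemma measurable_Cn_closed U : closed U -> measurable (U : set (Cn R n)).
Proof.
move=> cU; rewrite -[U]setCK; apply: measurableC; apply: measurable_Cn_open.
exact: closed_openC.
Qed.

(** A measurable cover of [X] pulls back to a cover of the preimage of [X] with
    the same total measure. *)
Lemma mu_ext_preserves d (S : measurableType d) (mu : {measure set S -> \bar R})
    (phi : S -> S) (X : set S) : preserves mu phi ->
  ((mu^*)%mu (phi @^-1` X) <= (mu^*)%mu X)%E.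
Proof.
move=> [mphi phiE]; apply: le_ereal_inf => _ [F [mF XF] <-].
exists (fun k => phi @^-1` F k).
  split; last by rewrite -preimage_bigcup; exact: preimage_subset.
  by move=> k; rewrite -[X in measurable X]setTI; exact: mphi.
by apply: eq_eseriesr => k _; exact: phiE.
Qed.

(* The interleaved real coordinates of [v]. *)
Let coords v (i : nat) : R :=
  let c := nth 0 [seq v ord0 j | j <- enum 'I_n] i./2 in
  if odd i then complex.Im c else complex.Re c.

Lemma Cn_of_rotate_tuple w v (t : n.*2.-tuple T) :
  Cn_of_reals (rotate_tuple (complex.Re w) (complex.Im w) (coords v) t) =
  w *: Cn_of_reals t + v.
Proof.
apply/rowP => j; rewrite !mxE !nth_mkseq ?ltn_double ?ltn_Sdouble//.
have cj : nth 0 [seq v ord0 j | j <- enum 'I_n] j = v ord0 j.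
  by rewrite (nth_map j) ?size_enum_ord// nth_ord_enum.
rewrite /= odd_double /= /coords /= odd_double /= uphalf_double doubleK cj.
case: w (v ord0 j) => [a b] [c d]; apply/eqP.
by rewrite eq_complex /=; apply/andP; split; apply/eqP; ring.
Qed.

Let modulus1_sqr w : modulus w = 1 -> complex.Re w ^+ 2 + complex.Im w ^+ 2 = 1.
Proof.
case: w => a b /(congr1 (fun r => r ^+ 2)).
by rewrite /modulus /= sqr_sqrtr ?addr_ge0 ?sqr_ge0// expr1n.
Qed.

Let lebesgue_outer_le w v A : modulus w = 1 ->
  (lebesgue_outer ((fun x => w *: x + v)%R @^-1` A) <= lebesgue_outer A)%E.
Proof.
move=> /modulus1_sqr w1; rewrite /lebesgue_outer.
have -> : Cn_of_reals (n:=n) @^-1` ((fun x => w *: x + v) @^-1` A) =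
    rotate_tuple (complex.Re w) (complex.Im w) (coords v) (m:=n.*2) @^-1` (Cn_of_reals
      (n:=n) @^-1` A).
  by apply/seteqP; split => t /=; rewrite Cn_of_rotate_tuple.
exact: (mu_ext_preserves _ (preserves_rotate_tuple (coords v) n w1)).
Qed.

(** The map and its inverse are both of this form, so the inequality of outer
    measures holds in both directions. *)
Lemma lebesgue_outer_isometry w v A : modulus w = 1 ->
  lebesgue_outer ((fun x => w *: x + v) @^-1` A) = lebesgue_outer A.
Proof.
move=> w1; apply/eqP; rewrite eq_le lebesgue_outer_le//=.
have w0 : w != 0 by apply: contra_eq_neq w1 => ->; rewrite modulus0 eq_sym oner_eq0.
have w1' : modulus w^-1 = 1.
  have : modulus (w * w^-1) = 1 by rewrite divff// modulus1.
  by rewrite modulusM w1 mul1r.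
have := lebesgue_outer_le (- (w^-1 *: v)) ((fun x => w *: x + v) @^-1` A) w1'.
apply: le_trans; apply: le_outer_measure => x Ax /=.
by rewrite scalerDr scalerN !scalerA divff// !scale1r subrK.
Qed.

Lemma preserves_isometry w v : modulus w = 1 ->
  preserves (@lambda R n) (fun x : Cn R n => (w *: (x : 'rV_n) + v : Cn R n)).
Proof.
move=> w1; set phi := (fun x => _).
split; last by move=> A _; exact: lebesgue_outer_isometry.
move=> _ A mA; rewrite setTI.
suff : caratheodory_measurable (@lebesgue_outer R n) (phi @^-1` A) by [].
have {}mA : caratheodory_measurable (@lebesgue_outer R n) A by [].
have w0 : w != 0 by apply: contra_eq_neq w1 => ->; rewrite modulus0 eq_sym oner_eq0.
move=> X.
pose Y := (fun x => w^-1 *: (x - v)) @^-1` X.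
have -> : X = phi @^-1` Y.
  apply/seteqP; split => x /=; rewrite /phi /Y /= addrK scalerA mulVf// scale1r//.
rewrite preimage_setC -!preimage_setI !(lebesgue_outer_isometry v _ w1).
exact: mA.
Qed.

End lambda_theory.

(** * Volume of Euclidean balls *)

Section disc_area.
Context (R : realType).
Local Notation T := (measurableTypeR R).
Local Notation leb := (@lebesgue_measure R).

Lemma lebesgue_sqr_lt (v : R) :
  leb [set x : T | ((x : R) ^+ 2 < v)%R] = (2 * Num.sqrt v)%:E.
Proof.
have [v0|v0] := leP v 0%R.
  rewrite ler0_sqrtr// mulr0 (_ : [set _ | _] = set0) ?measure0//.
  by apply/seteqP; split => x //= xv; have := sqr_ge0 x; rewrite leNgt (lt_le_trans xv v0).
rewrite (_ : [set _ | _] = `](- Num.sqrt v)%R, (Num.sqrt v)[%classic).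
  rewrite lebesgue_measure_itv/= lte_fin gtrN ?sqrtr_gt0// -EFinB opprK.
  by rewrite mulrDl mul1r.
apply/seteqP; split => x /=; rewrite in_itv/= -ltr_norml.
  by move=> xv; rewrite -sqrtr_sqr ltr_sqrt.
by move=> xv; rewrite -(sqr_sqrtr (ltW v0)) -[ltLHS]real_normK ?num_real// ltrXn2r.
Qed.

(** Substitute [y = r sin t]; the integrand becomes [2 r^2 cos^2 t]. *)
Lemma integral_half_disc (r : R) : (0 < r)%R ->
  (\int[leb]_(y in `[(- r)%R, r]) (2 * Num.sqrt (r ^+ 2 - y ^+ 2))%:E
  = (pi * r ^+ 2)%:E)%E.
Proof.
move=> r0; pose F (t : R) : R := (r * sin t)%R.
pose G (y : R) : R := (2 * Num.sqrt (r ^+ 2 - y ^+ 2))%R.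
have pi20 : (0 < pi / 2 :> R)%R by rewrite divr_gt0// pi_gt0.
have dF (t : R) : is_derive t (1 : R) F (r * cos t)%R.
  have h : is_derive t (1:R) (r *: (sin : R -> R)) (r *: cos t).
    exact: (is_deriveZ r (is_derive_sin t)).
  exact: h.
have F' : derive1 F = (fun t => r * cos t)%R.
  by apply/funext => t; rewrite derive1E; have [_ ->] := dF t.
have cF : continuous F.
  by move=> t; apply: cvgM; [exact: cvg_cst|exact: continuous_sin].
have cF' : continuous (fun t : R => r * cos t)%R.
  by move=> t; apply: cvgM; [exact: cvg_cst|exact: continuous_cos].
have Fa : F (- (pi / 2))%R = (- r)%R by rewrite /F sinN sin_pihalf mulrN1.
have Fb : F (pi / 2)%R = r by rewrite /F sin_pihalf mulr1.
have ab : (- (pi / 2) <= pi / 2 :> R)%R by lra.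
have := @integration_by_substitution_increasing R F G (- (pi / 2)) (pi / 2) ab.
rewrite Fa Fb => ->; first last.
- have sq : continuous (fun y : R => r ^+ 2 - y ^+ 2)%R.
    by move=> y; apply: cvgB; [exact: cvg_cst|exact: exprn_continuous].
  apply: continuous_subspaceT => y; apply: cvgM; first exact: cvg_cst.
  by apply: (continuous_comp (sq y)); exact: sqrt_continuous.
- split; first by move=> t _; have [] := dF t.
    by apply: cvg_at_right_filter; exact: cF.
  by apply: cvg_at_left_filter; exact: cF.
- by rewrite F'; apply/cvg_ex; eexists; apply: cvg_at_left_filter; exact: cF'.
- by rewrite F'; apply/cvg_ex; eexists; apply: cvg_at_right_filter; exact: cF'.
- by rewrite F' => t _; exact: cF'.
- move=> x y; rewrite !in_itv/= => xab yab xy; rewrite /F ltr_pM2l//.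
  by rewrite ltr_sin// in_itv.
rewrite F'.
pose H (t : R) : R := (r ^+ 2 * (t + sin t * cos t))%R.
have dH (t : R) : is_derive t (1 : R) H (r ^+ 2 * (2 * cos t ^+ 2))%R.
  have h : is_derive t (1:R) (r ^+ 2 *: (id + (sin : R -> R) * cos)) (r ^+ 2 *: (1 +
    (sin t *: (- sin t) + cos t *: cos t)))%R.
    exact: (is_deriveZ _ (is_deriveD (is_derive_id t 1) (is_deriveM (is_derive_sin t)
      (is_derive_cos t)))).
  apply: is_derive_eq h _; congr (_ * _)%R.
  rewrite /GRing.scale /= mulrN -!expr2 sin2cos2; ring.
transitivity (\int[leb]_(t in `[(- (pi / 2))%R, (pi / 2)%R]) (r ^+ 2 * (2 * cos t ^+
  2))%:E)%E.
  apply: eq_integral => t; rewrite inE/= in_itv/= => tab.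
  have c0 : (0 <= cos t)%R by exact: cos_ge0_pihalf.
  rewrite fctE /= /G /F; congr EFin.
  have -> : (r ^+ 2 - (r * sin t) ^+ 2 = (r * cos t) ^+ 2)%R.
    by rewrite !exprMn sin2cos2; ring.
  by rewrite sqrtr_sqr ger0_norm ?mulr_ge0 ?(ltW r0)//; ring.
have cH : continuous H.
  move=> t; apply: cvgM; first exact: cvg_cst.
  apply: cvgD; first exact: cvg_id.
  by apply: cvgM; [exact: continuous_sin|exact: continuous_cos].
rewrite (@continuous_FTC2 _ _ H).
- rewrite /H sin_pihalf sinN cosN cos_pihalf !mulr0 !addr0 -EFinB; congr EFin.
  by field.
- by lra.
- apply: continuous_subspaceT => t; apply: cvgM; first exact: cvg_cst.
  apply: cvgM; first exact: cvg_cst.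
  apply: (@continuous_comp _ _ _ (@cos R) (fun x : R => x ^+ 2));
    first exact: continuous_cos.
  exact: exprn_continuous.
- split; first by move=> t _; have [] := dH t.
    by apply: cvg_at_right_filter; exact: cH.
  by apply: cvg_at_left_filter; exact: cH.
- by move=> t _; rewrite derive1E; have [_ ->] := dH t.
Qed.

Lemma area_disc (u : R) :
  (leb \x leb)%E [set p : T * T | ((p.2 : R) ^+ 2 + (p.1 : R) ^+ 2 < u)%R]
  = (pi * Num.max 0 u)%:E.
Proof.
rewrite /product_measure1.
transitivity (\int[leb]_(y in setT) (2 * Num.sqrt (u - y ^+ 2))%:E)%E.
  apply: eq_integral => y _ /=; rewrite -lebesgue_sqr_lt xsectionE.
  by congr (leb _); apply/seteqP; split => x /=; rewrite ltrBrDr.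
have [u0|u0] := leP u 0%R.
  rewrite mulr0; apply: integral0_eq => y _.
  by rewrite ler0_sqrtr ?mulr0// subr_le0 (le_trans u0)// sqr_ge0.
have r0 : (0 < Num.sqrt u)%R by rewrite sqrtr_gt0.
rewrite -(sqr_sqrtr (ltW u0)) -integral_half_disc// [RHS]integral_mkcond.
apply: eq_integral => y _; rewrite patchE; case: ifPn => //.
rewrite sqr_sqrtr ?(ltW u0)// notin_setE /= in_itv/= -ler_norml => /negP;
  rewrite -ltNge => uy.
rewrite ler0_sqrtr ?mulr0// subr_le0 -[leRHS]real_normK ?num_real//.
have u2 := sqr_sqrtr (ltW u0); rewrite -[leLHS]u2.
by apply: lerXn2r; rewrite ?nnegrE ?sqrtr_ge0 ?normr_ge0// ltW.
Qed.

End disc_area.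

Section ball_volume.
Context (R : realType).
Local Notation T := (measurableTypeR R).
Local Notation leb := (@lebesgue_measure R).

Lemma integral_exprB (n : nat) (c s : R) : 0 < s ->
  (\int[leb]_(x in `[0%R, s]) (c * (s - x) ^+ n)%:E
  = (c / n.+1%:R * s ^+ n.+1)%:E)%E.
Proof.
move=> s0.
pose F (x : R) : R := (- (c / n.+1%:R)) * (s - x) ^+ n.+1.
have n0 : n.+1%:R != 0 :> R by rewrite pnatr_eq0.
have dB (x : R) : is_derive x (1 : R) (cst s - id : R -> R) (0 - 1 : R).
  exact: (is_deriveB (is_derive_cst s x 1) (is_derive_id x 1)).
have dF (x : R) : is_derive x (1 : R) F (c * (s - x) ^+ n).
  have h := is_deriveZ (- (c / n.+1%:R)) (@is_deriveX _ _ _ n.+1 _ _ _ (dB x)).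
  have -> : F = (- (c / n.+1%:R)) \*: ((cst s - id : R -> R) ^+ n.+1).
    apply/funext => y; rewrite /F /=; congr (_ * _).
    by elim: n.+1 => [|k IH]; rewrite ?expr0// !exprS IH.
  apply: is_derive_eq h _; rewrite /GRing.scale /=.
  by rewrite sub0r; field.
have cB : continuous (fun x : R => s - x).
  by move=> x; apply: cvgB; [exact: cvg_cst|exact: cvg_id].
have cX k : continuous (fun x : R => (s - x) ^+ k).
  by move=> x; apply: (@continuous_comp _ _ _ (fun x : R => s - x) (fun x : R => x ^+
    k)); [exact: cB|exact: exprn_continuous].
have cF : continuous F.
  by move=> x; apply: cvgM; [exact: cvg_cst|exact: cX].
rewrite (@continuous_FTC2 _ _ F)//.
- by rewrite /F subrr subr0 expr0n /= mulr0 -EFinB sub0r mulNr opprK.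
- by apply: continuous_subspaceT => x; apply: cvgM; [exact: cvg_cst|exact: cX].
- split; first by move=> x _; have [] := dF x.
    by apply: cvg_at_right_filter; exact: cF.
  by apply: cvg_at_left_filter; exact: cF.
- by move=> x _; rewrite derive1E; have [_ ->] := dF x.
Qed.

Definition sumsq m (t : m.-tuple T) : R := \sum_(i < m) nth 0 (t : seq R) i ^+ 2.

Lemma measurable_sumsq m : measurable_fun setT (fun t : m.-tuple T => (sumsq t : T)).
Proof.
apply: measurable_sum => i; apply: measurable_funX; exact: measurable_nth_tuple.
Qed.

Lemma measurable_sumsq_lt m (s : R) : measurable [set t : m.-tuple T | sumsq t < s].
Proof.
have := @measurable_sumsq m measurableT _ (measurable_itv `]-oo, s[); rewrite setTI.
by congr (measurable _); apply/seteqP; split => p /=; rewrite in_itv.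
Qed.

Lemma sumsq_tcons2 m (t : m.-tuple T) (p : T * T) :
  sumsq (tcons2 (t, p)) = (p.2 : R) ^+ 2 + (p.1 : R) ^+ 2 + sumsq t.
Proof. by rewrite /sumsq 2!big_ord_recl /= addrA. Qed.

(** The disc of radius squared [u] has area [pi * u], the length of an interval
    times [pi]; exchanging the integrals shows that the volume in two more
    dimensions is [pi] times a primitive of the volume. *)
Lemma volume_sumsq n (s : R) :
  power_measure leb n.*2 [set t | sumsq t < s] =
  (if 0 < s then pi ^+ n / n`!%:R * s ^+ n else 0)%:E.
Proof.
elim: n s => [|n IH] s.
  rewrite /power_measure /= diracE /sumsq.
  case: ifPn => s0.
    by rewrite mem_set /= ?big_ord0// !expr0 fact0 divr1 mulr1.
  by rewrite memNset //= big_ord0; exact/negP.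
rewrite doubleS power_measureSS; last exact: measurable_sumsq_lt.
(* The section of [E] over [t] is empty or an interval of length [s - sumsq t]. *)
pose E : set (n.*2.-tuple T * T) := [set p | 0 < (p.2 : R) /\ sumsq p.1 < s - p.2].
have mE : measurable E.
  have mf : measurable_fun setT (fun p : n.*2.-tuple T * T => (s - p.2 - sumsq p.1 : T)).
    apply: measurable_funB; last exact: (measurableT_comp (@measurable_sumsq _)
      measurable_fst).
    by apply: measurable_funB; [exact: measurable_cst|exact: measurable_snd].
  have -> : E = ((fun p => p.2) @^-1` `]0, +oo[) `&`
      ((fun p : n.*2.-tuple T * T => (s - p.2 - sumsq p.1 : T)) @^-1` `]0, +oo[).
    by apply/seteqP; split => p /=; rewrite !in_itv /= !andbT subr_gt0.
  apply: measurableI; rewrite -[X in measurable X]setTI.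
    exact: measurable_snd.
  exact: mf.
transitivity (pi%:E * (power_measure leb n.*2 \x leb) E)%E.
  have mx := @measurable_fun_xsection _ _ _ _ _ leb _ mE.
  rewrite /product_measure1 -(ge0_integralZl _ measurableT mx); last 2 first.
  - by move=> t _; exact: measure_ge0.
  - by rewrite lee_fin pi_ge0.
  apply: eq_integral => t _.
  transitivity ((leb \x leb)%E [set p : T * T | (p.2 : R) ^+ 2 + (p.1 : R) ^+ 2 < s -
    sumsq t]).
    rewrite /= /square_measure; congr ((_ \x _) _)%E; apply/seteqP; split => p /=;
      by rewrite /xsection /= inE /= sumsq_tcons2 ltrBrDr.
  rewrite area_disc EFinM; congr (_ * _)%E; rewrite /= xsectionE.
  rewrite (_ : _ @^-1` E = `]0, s - sumsq t[%classic); last first.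
    apply/seteqP; split => x /=; rewrite in_itv/=.
      by move=> [x0 ?]; apply/andP; split=> //; rewrite ltrBrDl -ltrBrDr.
    by move=> /andP[x0 ?]; split=> //; rewrite ltrBrDr -ltrBrDl.
  rewrite lebesgue_measure_itv/= lte_fin.
  by case: ltP => // _; rewrite oppr0 addr0.
transitivity (pi%:E * (power_measure leb n.*2 \x^ leb) E)%E.
  congr (_ * _)%E; apply: (@product_measure_unique _ _ _ _ _ (power_measure leb n.*2)
    leb) => // A B mA mB.
  exact: product_measure2E.
have sec y : power_measure leb n.*2 (ysection E y) =
    (if 0 < (y : R) < s then pi ^+ n / n`!%:R * (s - y) ^+ n else 0)%:E.
  have [y0|y0] := ltP 0 (y : R); last first.
    rewrite (_ : ysection E y = set0) ?measure0//.
    apply/seteqP; split => t //=; rewrite ysectionE /E /= => -[yp _].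
    by move: y0; rewrite leNgt yp.
  rewrite -subr_gt0 -IH; congr (power_measure _ _ _); rewrite ysectionE.
  by apply/seteqP; split => t /=; [case|].
have [s0|s0] := ltP 0 s; last first.
  rewrite [X in (_ * X)%E](_ : _ = 0%E) ?mule0//; apply: integral0_eq => y _ /=.
  by rewrite sec; case: ifPn => // /andP[y0 ys]; have := lt_trans y0 ys; rewrite ltNge s0.
rewrite [X in (_ * X)%E](_ : _ = (\int[leb]_(x in `[0%R, s]) (pi ^+ n / n`!%:R * (s -
  x) ^+ n)%:E)%E); last first.
  rewrite /product_measure2 [RHS]integral_itv_bndoo; last first.
    apply/measurable_EFinP; apply: measurable_funM; first exact: measurable_cst.
    by apply: measurable_funX; apply: measurable_funB.
  rewrite [RHS]integral_mkcond; apply: eq_integral => y _ /=.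
  rewrite sec patchE; case: ifPn => [ys|/negP ys]; case: ifPn => //.
    by rewrite notin_setE /= in_itv /= ys.
  by rewrite inE /= in_itv /= => /ys.
rewrite integral_exprB// -EFinM; congr EFin.
rewrite !exprS factS natrM; field.
by rewrite nat1r !pnatr_eq0 -lt0n fact_gt0.
Qed.

Lemma sum_double (V : nmodType) (F : nat -> V) n :
  \sum_(i < n.*2) F i = \sum_(j < n) (F j.*2 + F j.*2.+1).
Proof.
elim: n => [|m IH]; first by rewrite !big_ord0.
by rewrite doubleS !big_ord_recr /= IH addrA.
Qed.

Lemma volume_eball n (z : 'rV[Cplx R]_n) (r : R) : 0 < r ->
  lambda (eball z r) = (pi ^+ n / n`!%:R * r ^+ (2 * n))%:E.
Proof.
move=> r0.
have -> : eball z r = (fun x => 1 *: x + - z) @^-1` eball 0 r.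
  by apply/seteqP; split => x; rewrite /eball /= scale1r subr0.
rewrite [LHS]lebesgue_outer_isometry ?modulus1//.
have E : @Cn_of_reals R n @^-1` eball 0 r = [set t | sumsq t < r ^+ 2].
  have eqn (t : n.*2.-tuple T) : enorm (Cn_of_reals t) ^+ 2 = sumsq t.
    rewrite sqr_enorm /sumsq; under eq_bigr => j _.
      rewrite mxE /modulus /= sqr_sqrtr ?addr_ge0 ?sqr_ge0//; over.
    by rewrite [RHS](sum_double (fun i => nth 0 (t : seq R) i ^+ 2)).
  apply/seteqP; split => t /=; rewrite /eball /= subr0 -eqn.
    by rewrite ltr_pXn2r ?nnegrE ?enorm_ge0 ?(ltW r0).
  by rewrite ltr_pXn2r ?nnegrE ?enorm_ge0 ?(ltW r0).
rewrite -[LHS]/(lambda (eball 0 r)) lambdaE E; last exact: measurable_sumsq_lt.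
by rewrite volume_sumsq exprn_gt0// -exprM.
Qed.

End ball_volume.

(** * The sub-mean value inequality for [ln |f|] *)

Section measurability_on_Cn.
Context (R : realType) (n : nat).

Lemma measurable_fun_Cn_continuous (D : set 'rV[Cplx R]_n) (u : 'rV[Cplx R]_n -> R) :
  open D -> (forall x, D x -> {for x, continuous u}) ->
  measurable_fun (D : set (Cn R n)) (u : Cn R n -> R).
Proof.
move=> oD uD; apply: (measurability _ (RGenOInfty.measurableE R)) => _ [_ [a ->] <-].
apply: measurable_Cn_open; rewrite openE => x [Dx ux].
apply: filterI; first exact: open_nbhs_nbhs.
apply: (uD x Dx); apply: open_nbhs_nbhs; split; last exact: ux.
exact: interval_open.
Qed.

Lemma open_eball (z : 'rV[Cplx R]_n) r : open (eball z r).
Proof.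
have -> : eball z r = (fun x => enorm (x - z)) @^-1` [set a | a < r] by [].
by apply: open_comp; [move=> x _; exact: enorm_continuous|exact: open_lt].
Qed.

Lemma measurable_eball (z : 'rV[Cplx R]_n) r : measurable (eball z r : set (Cn R n)).
Proof. exact/measurable_Cn_open/open_eball. Qed.

End measurability_on_Cn.

Section sub_mean_value.
Context (R : realType) (n : nat).
Variables (f : 'rV[Cplx R]_n -> Cplx R) (z : 'rV[Cplx R]_n) (r M : R).
Hypotheses (r_gt0 : 0 < r) (fz0 : f z != 0).
Hypothesis df : forall x, closed_eball z r x -> differentiable f x.
Hypotheses (M_ge0 : 0 <= M) (fM : forall x, closed_eball z r x -> modulus (f x) <= expR M).

Let B : set (Cn R n) := eball z r.
Let V : R := pi ^+ n / n`!%:R * r ^+ (2 * n).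
Let L : R := ln (modulus (f z)).

Let V_gt0 : 0 < V.
Proof. by rewrite mulr_gt0 ?exprn_gt0// divr_gt0 ?exprn_gt0 ?pi_gt0// ltr0n fact_gt0. Qed.

Let lambdaB : lambda B = V%:E.
Proof. exact: volume_eball. Qed.

Let mB : measurable B.
Proof. exact: measurable_eball. Qed.

Let B_closed x : B x -> closed_eball z r x.
Proof. exact: ltW. Qed.

(* Subtracting from the upper bound [M] gives a nonnegative function, which
   increases as [eps] decreases. *)
Let gap eps (x : Cn R n) : \bar R := (M - log_trunc f eps x)%:E.

Let gap_ge0 eps x : 0 < eps <= 1 -> B x -> (0 <= gap eps x)%E.
Proof.
move=> /andP[e0 e1] /B_closed/fM fxM; rewrite lee_fin subr_ge0.
rewrite -ler_expR /log_trunc lnK ?posrE ?lt_max ?e0 ?orbT//.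
by rewrite ge_max fxM (le_trans e1)// -expR0 ler_expR.
Qed.

Let gap_measurable eps : 0 < eps -> measurable_fun B (gap eps).
Proof.
move=> e0; apply/measurable_EFinP.
apply: measurable_fun_Cn_continuous; first exact: open_eball.
move=> x /B_closed/df/differentiable_continuous fx.
exact: (@continuousB _ R^o _ (cst M) (log_trunc f eps) x (@cst_continuous _ _ M x)
  (log_trunc_continuous e0 fx)).
Qed.

(* The integrals of the functions [gap eps (rho k x)] over [B] are all equal by
   invariance, and their sum is bounded pointwise by [log_le_rotation_mean]. *)
Let gap_integral_le eps : 0 < eps <= 1 ->
  (\int[lambda]_(x in B) gap eps x <= ((M - L) * V)%:E)%E.
Proof.
move=> eps01; have /andP[eps0 _] := eps01.
apply/lee_addgt0Pr => e e0.
have e'0 : 0 < e / V by rewrite divr_gt0.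
have [N [w [N0 w1 HN]]] := log_le_rotation_mean (ltW r_gt0) eps0 e'0 df fz0.
pose rho k (x : Cn R n) : Cn R n := w ^+ k *: (x : 'rV_n) + (z - w ^+ k *: z).
have wk k : modulus (w ^+ k) = 1 by rewrite modulusX w1 expr1n.
have rhoE k x : rho k x = z + w ^+ k *: (x - z).
  by rewrite /rho scalerBr addrCA.
have rhoB k : rho k @^-1` B = B.
  apply/seteqP; split => x; rewrite /B /eball /= rhoE addrAC subrr add0r;
    by rewrite enormZ wk mul1r.
have Prho k : preserves (@lambda R n) (rho k) by exact: preserves_isometry.
have gap_rho_ge0 k x : B x -> (0 <= gap eps (rho k x))%E.
  move=> Bx; have : (rho k @^-1` B) x by rewrite rhoB.
  exact: gap_ge0.
have mgap_rho k : measurable_fun B (fun x => gap eps (rho k x)).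
  apply: (measurable_comp mB _ (gap_measurable eps0) (measurable_funTS (Prho k).1)).
  by move=> _ [x Bx <-]; move: Bx; rewrite -{1}(rhoB k).
have step : (\int[lambda]_(x in B) (\sum_(k < N) gap eps (rho k x)) =
    (\int[lambda]_(x in B) gap eps x) *+ N)%E.
  rewrite (ge0_integral_sum _ mB (fun k : 'I_N => mgap_rho k)
    (fun k : 'I_N => @gap_rho_ge0 k)).
  rewrite (eq_bigr (fun=> \int[lambda]_(x in B) gap eps x)%E) => [|k _].
    by rewrite sumr_const card_ord.
  rewrite -[in LHS](rhoB k); apply: (preserves_integral (Prho k) mB (gap_measurable eps0)).
  by move=> x; exact: gap_ge0.
have bound : (\int[lambda]_(x in B) (\sum_(k < N) gap eps (rho k x)) <=
    ((M - L + e / V) *+ N)%:E * V%:E)%E.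
  rewrite -lambdaB -(integral_cst lambda mB); apply: (ge0_le_integral _ mB).
  - by move=> x Bx; apply: sume_ge0 => k _; exact: gap_rho_ge0.
  - by apply: emeasurable_sum => k; exact: mgap_rho.
  - exact: measurable_cst.
  move=> x Bx; rewrite sumEFin lee_fin sumrB sumr_const card_ord.
  have -> : \sum_(k < N) log_trunc f eps (rho k x) =
      \sum_(k < N) log_trunc f eps (z + w ^+ k *: (x - z)).
    by apply: eq_bigr => k _; rewrite rhoE.
  have := HN x (B_closed Bx); rewrite -/L.
  rewrite mulrnDl mulrnBl; lra.
move: bound; rewrite step; case: (\int[lambda]_(x in B) _)%E => [i| |].
- rewrite -EFin_natmul -EFinM -EFinD !lee_fin mulrnAl => h.
  have : i <= (M - L + e / V) * V by move: h; rewrite ler_pMn2r.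
  by rewrite mulrDl divfK ?gt_eqF.
- by rewrite -(prednK N0) enatmul_pinfty -EFinM leye_eq.
- by rewrite leNye.
Qed.

(** Monotone convergence as the truncation level tends to [0]; in particular
    [ln |f|] is integrable on the ball. *)
Lemma sub_mean_value_log :
  measurable_fun B (fun x => M%:E - lne (modulus (f x))%:E)%E /\
  (\int[lambda]_(x in B) (M%:E - lne (modulus (f x))%:E) <= ((M - L) * V)%:E)%E.
Proof.
pose eps (k : nat) : R := k.+1%:R^-1.
have eps0 k : 0 < eps k by rewrite invr_gt0 ltr0n.
have eps1 k : 0 < eps k <= 1 by rewrite eps0 /= invf_le1 ?ltr0n// ler1n.
have nd x : B x -> {homo (fun k => gap (eps k) x) : m k / (m <= k)%N >-> (m <= k)%E}.
  move=> Bx m k mk; rewrite lee_fin lerD2l lerN2 ler_ln ?posrE ?lt_max ?eps0 ?orbT//.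
  rewrite ge_max le_max lexx /= le_max; apply/orP; right.
  by rewrite lef_pV2 ?posrE ?ltr0n// ler_nat.
have lim x : limn (fun k => gap (eps k) x) = (M%:E - lne (modulus (f x))%:E)%E.
  apply/cvg_lim => //.
  have [fx0|fx0] := eqVneq (modulus (f x)) 0.
    rewrite fx0 /lne lexx /=; apply/cvgeyPge => A.
    near=> k; rewrite lee_fin /log_trunc fx0 (max_r (ltW (eps0 k))) /eps lnV ?posrE
      ?ltr0n// opprK.
    rewrite -lerBlDl -ler_expR lnK ?posrE ?ltr0n//.
    near: k; exists (Num.bound (expR (A - M))) => // k /= hk.
    rewrite (le_trans (ltW (archi_boundP (expR_ge0 _))))// ler_nat.
    exact: leq_trans hk _.
  have fx1 : 0 < modulus (f x) by rewrite lt_neqAle eq_sym fx0 modulus_ge0.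
  rewrite lne_EFin// -EFinB; apply: cvg_near_cst; near=> k.
  rewrite /gap /log_trunc max_l//.
  rewrite /eps invf_ple ?posrE ?ltr0n//.
  near: k; exists (Num.bound (modulus (f x))^-1) => // k /= hk.
  have : 0 <= (modulus (f x))^-1 by rewrite invr_ge0 ltW.
  move=> /archi_boundP/ltW/le_trans; apply; rewrite ler_nat.
  exact: leq_trans hk _.
have -> : (fun x => M%:E - lne (modulus (f x))%:E)%E = (fun x => limn (fun k => gap
  (eps k) x)).
  by apply/funext => x; rewrite lim.
have cv := @cvg_monotone_convergence _ _ _ (@lambda R n) B mB (fun k => gap (eps k))
  (fun k => gap_measurable (eps0 k)) (fun k x => @gap_ge0 _ x (eps1 k)) nd.
split.
  apply: (emeasurable_fun_cvg (fun k => gap (eps k))).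
    by move=> k; exact: gap_measurable.
  move=> x Bx; apply: ereal_nondecreasing_is_cvgn; exact: nd.
rewrite -(cvg_lim _ cv)//; apply: lime_le; first by apply/cvg_ex; eexists; exact: cv.
by apply: nearW => k; exact: gap_integral_le.
Unshelve. all: by end_near. Qed.

End sub_mean_value.

(** * Jensen's inequality for the weight *)

Lemma measurable_fun_expeR d (T : measurableType d) (R : realType) (D : set T)
    (g : T -> \bar R) : measurable D -> measurable_fun D g ->
  measurable_fun D (fun x => expeR (g x)).
Proof.
move=> mD mg; apply: (measurability _ (ErealGenOInfty.measurableE R)) => _ [_ [a ->] <-].
have [a0|a0] := ltP a 0.
  rewrite (_ : _ `&` _ = D)//; apply/seteqP; split => [x []//|x Dx]; split=> //=.
  by rewrite in_itv/= andbT (lt_le_trans _ (expeR_ge0 _))// lte_fin.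
have [b aE] : exists b, a%:E = expeR b.
  by exists (lne a%:E); rewrite lneK// in_itv/= lee_fin a0 leey.
rewrite (_ : _ `&` _ = D `&` [set x | (b < g x)%E]); last first.
  by apply/seteqP; split => x /= [Dx]; rewrite in_itv/= andbT aE lte_expeR.
exact: emeasurable_fun_o_infty.
Qed.

(** For [y = a^p e^-w] this is the tangent line inequality
    [ln y <= y / c - 1 + ln c]. Adding the terms in [M] and [K] and separating
    the positive and negative parts of [w] lets both sides be integrated as
    nonnegative functions; where [a] is zero or [w] is infinite, the right-hand
    side is [+oo]. *)
Lemma tangent_line (R : realType) (a p c M K : R) (w : \bar R) :
  0 <= a -> 0 < p -> 0 < c ->
  ((p * M + 1 + K)%:E + maxe (- w) 0 <=
   maxe w 0 + c^-1%:E * ((a `^ p)%:E * expeR (- w)) +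
   (p%:E * (M%:E - lne a%:E) + (ln c + K)%:E))%E.
Proof.
move=> a0 p0 c0.
have c10 : (0 <= c^-1%:E :> \bar R)%E by rewrite lee_fin invr_ge0 ltW.
have [->|ann] := eqVneq a 0.
  rewrite /lne lexx /= gt0_muley ?lte_fin//.
  rewrite powR0 ?gt_eqF// mul0e mule0 adde0 addye//.
  have w0 : maxe w 0 != -oo%E by rewrite gt_eqF// (lt_le_trans ltNy0)// le_max lexx orbT.
  by rewrite addey// leey.
have a1 : 0 < a by rewrite lt_neqAle eq_sym ann.
rewrite lne_EFin//.
case: w => [w| |] /=.
- rewrite -!EFin_max -!EFinM -!EFinD lee_fin.
  have := expR_ge1Dx (p * ln a - w - ln c).
  have -> : expR (p * ln a - w - ln c) = c^-1 * (a `^ p * expR (- w)).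
    by rewrite /powR (negbTE ann) !expRD [expR (- ln c)]expRN lnK ?posrE//; ring.
  have -> : Num.max w 0 = w + Num.max (- w) 0.
    have [w0|w0] := leP w 0; first by rewrite max_l ?oppr_ge0// subrr.
    by rewrite max_r ?oppr_le0 ?ltW// addr0.
  lra.
- rewrite (max_l (leey _)) (max_r (leNye _)) adde0.
  by rewrite mule0 mule0 adde0 addye// leey.
- rewrite (max_l (leey _)) (max_r (leNye _)) add0e gt0_muley; last first.
    by rewrite lte_fin powR_gt0.
  by rewrite gt0_muley ?lte_fin ?invr_gt0// addye ?leey.
Qed.

Section bound_on_a_ball.
Context (R : realType) (n : nat).
Variables (O : set 'rV[Cplx R]_n) (p : R) (w : 'rV[Cplx R]_n -> \bar R).
Variables (f : 'rV[Cplx R]_n -> Cplx R) (z : 'rV[Cplx R]_n) (r : R).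
Hypotheses (openO : open O) (p_gt0 : 0 < p).
Hypotheses (w_loc : locally_integrable_on O w) (f_holo : holomorphic_on O f).
Hypotheses (r_gt0 : 0 < r) (KO : closed_eball z r `<=` O).

Let B : set (Cn R n) := eball z r.
Let V : R := pi ^+ n / n`!%:R * r ^+ (2 * n).
Let F (x : Cn R n) : \bar R := ((modulus (f x) `^ p)%:E * expeR (- w x))%E.

Let V_gt0 : 0 < V.
Proof. by rewrite mulr_gt0 ?exprn_gt0// divr_gt0 ?exprn_gt0 ?pi_gt0// ltr0n fact_gt0. Qed.

Let mB : measurable B.
Proof. exact: measurable_eball. Qed.

Let mO : measurable (O : set (Cn R n)).
Proof. exact: measurable_Cn_open. Qed.

Let BK : B `<=` closed_eball z r.
Proof. by move=> x; exact: ltW. Qed.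

Let BO : B `<=` O.
Proof. exact: subset_trans KO. Qed.

Let F_ge0 x : (0 <= F x)%E.
Proof. by rewrite mule_ge0 ?expeR_ge0// lee_fin powR_ge0. Qed.

Let mF : measurable_fun (O : set (Cn R n)) F.
Proof.
apply: emeasurable_funM.
  apply/measurable_EFinP; apply: (measurableT_comp (@measurable_powR R p)).
  apply: measurable_fun_Cn_continuous => // x /f_holo/differentiable_continuous fx.
  by apply: (@continuous_comp _ _ _ f (@modulus R)) => //; exact: modulus_continuous.
by apply: (measurable_fun_expeR mO); apply: measurableT_comp w_loc.1;
  exact: oppe_measurable.
Qed.

Let w_integrable : (@lambda R n).-integrable B w.
Proof.
have mK : measurable (closed_eball z r : set (Cn R n)).
  exact/measurable_Cn_closed/closed_closed_eball.
have mwK : measurable_fun (closed_eball z r : set (Cn R n)) w.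
  exact: measurable_funS mO KO w_loc.1.
apply/integrableP; split; first exact: measurable_funS mK BK mwK.
apply: le_lt_trans (w_loc.2 _ KO (@compact_closed_eball _ _ z r)).
have mabs := measurableT_comp (@abse_measurable R setT) mwK.
exact: (ge0_subset_integral _ mB mK mabs (fun x _ => abse_ge0 _) BK).
Qed.

Let f_bounded : exists2 M, 0 <= M & forall x, closed_eball z r x -> modulus (f x) <= expR M.
Proof.
have K0 : closed_eball z r !=set0.
  exists z; rewrite /closed_eball /= subrr -(scale0r (0 : 'rV_n)) enormZ modulus0 mul0r.
  exact: ltW.
have [|c _ cM] := compact_EVT_max K0 (@compact_closed_eball _ _ z r) (f := fun x =>
  modulus (f x)).
  apply: continuous_in_subspaceT => x /set_mem/KO/f_holo/differentiable_continuous fx.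
  by apply: (@continuous_comp _ _ _ f (@modulus R)) => //; exact: modulus_continuous.
exists (modulus (f c)); first exact: modulus_ge0.
move=> x Kx; rewrite (le_trans (cM _ (mem_set Kx)))//.
by rewrite (le_trans _ (expR_ge1Dx _))// lerDr.
Qed.

(** Integrate the tangent line inequality over the ball with [c = J / V], an
    upper bound for the mean of [|f|^p e^-w]: the terms [y / c] and [-1] then
    contribute at most zero, and [sub_mean_value_log] bounds the mean of
    [ln |f|] from below. *)
Lemma log_modulus_le_ball (J : R) : f z != 0 -> 0 < J ->
  (\int[lambda]_(x in O) F x <= J%:E)%E ->
  exists2 W, (\int[lambda]_(x in B) w x = W%:E)%E &
    p * ln (modulus (f z)) <= W / V + ln (J / V).
Proof.
move=> fz0 J0 FJ.
have [M M0 fM] := f_bounded.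
have df x : closed_eball z r x -> differentiable f x by move=> /KO/f_holo.
have [mphi] := sub_mean_value_log r_gt0 fz0 df M0 fM.
rewrite -/V -/B; set phi := fun x : Cn R n => _; set L := ln _ => Phi_le.
have phi0 x : B x -> (0 <= phi x)%E.
  move=> /BK/fM fxM; rewrite /phi; have [fx0|fx0] := eqVneq (modulus (f x)) 0.
    by rewrite fx0 /lne lexx /= leey.
  have fx1 : 0 < modulus (f x) by rewrite lt_neqAle eq_sym fx0 modulus_ge0.
  by rewrite lne_EFin// -EFinB lee_fin subr_ge0 -ler_expR lnK ?posrE.
have lamB : lambda B = V%:E by exact: volume_eball.
have /integrable_funepos wp := w_integrable.
have /integrable_funeneg wn := w_integrable.
have [Wp WpE] : exists Wp, (\int[lambda]_(x in B) w^\+ x = Wp%:E)%E.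
  have /fineK <- := integrable_fin_num mB (wp mB).
  by eexists.
have [Wn WnE] : exists Wn, (\int[lambda]_(x in B) w^\- x = Wn%:E)%E.
  have /fineK <- := integrable_fin_num mB (wn mB).
  by eexists.
exists (Wp - Wn); first by rewrite integralE WpE WnE.
have [I IE] : exists I, (\int[lambda]_(x in B) F x = I%:E)%E /\ I <= J.
  have IJ : (\int[lambda]_(x in B) F x <= J%:E)%E.
    by apply: le_trans FJ; apply: ge0_subset_integral.
  have I0 : (0 <= \int[lambda]_(x in B) F x)%E by exact: integral_ge0.
  case: (\int[lambda]_(x in B) F x)%E IJ I0 => [I| |] //; rewrite lee_fin => IJ _.
  by exists I.
have [Phi [PhiE Phi_leV]] : exists Phi, (\int[lambda]_(x in B) phi x = Phi%:E)%E /\ Phi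
  <= (M - L) * V.
  have P0 : (0 <= \int[lambda]_(x in B) phi x)%E by exact: integral_ge0.
  case: (\int[lambda]_(x in B) phi x)%E Phi_le P0 => [P| |] //; rewrite lee_fin => PJ _.
  by exists P.
(* [K] makes the constants on both sides of [tangent_line] nonnegative. *)
pose c := J / V; pose K := `|ln c|.
have c0 : 0 < c by rewrite divr_gt0.
have K1 : 0 <= ln c + K by rewrite /K; have := ler_norm (- ln c); rewrite normrN; lra.
have K2 : 0 <= p * M + 1 + K.
  by have := mulr_ge0 (ltW p_gt0) M0; have := normr_ge0 (ln c); rewrite -/K; lra.
have mFB : measurable_fun B F by exact: measurable_funS mO BO mF.
have mwp : measurable_fun B (w^\+)%E by exact: measurable_int (wp mB).
have mwn : measurable_fun B (w^\-)%E by exact: measurable_int (wn mB).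
have cF0 x : (0 <= c^-1%:E * F x)%E by rewrite mule_ge0// lee_fin invr_ge0 ltW.
have pphi0 x : B x -> (0 <= p%:E * phi x)%E.
  by move=> Bx; rewrite mule_ge0 ?phi0// lee_fin ltW.
have mcF : measurable_fun B (fun x => c^-1%:E * F x)%E by exact: measurable_funeM.
have mpphi : measurable_fun B (fun x => p%:E * phi x)%E by exact: measurable_funeM.
have main : (\int[lambda]_(x in B) ((p * M + 1 + K)%:E + w^\- x) <=
    \int[lambda]_(x in B) ((w^\+ x + c^-1%:E * F x) + (p%:E * phi x + (ln c + K)%:E)))%E.
  apply: (ge0_le_integral _ mB).
  - by move=> x _; rewrite adde_ge0 ?lee_fin.
  - by apply: emeasurable_funD => //; exact: measurable_cst.
  - apply: emeasurable_funD; first exact: emeasurable_funD.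
    by apply: emeasurable_funD => //; exact: measurable_cst.
  move=> x _; rewrite funeposE funenegE /phi /F.
  exact: (tangent_line M K (w x) (modulus_ge0 (f x)) p_gt0 c0).
have cstI k : (\int[lambda]_(x in B) (cst k%:E x) = (k * V)%:E)%E.
  by rewrite EFinM -lamB; exact: integral_cst.
rewrite (ge0_integralD _ mB) in main;
  [|by move=> *|exact: measurable_cst|by move=> *|exact: mwn].
rewrite (ge0_integralD _ mB) in main; last first.
- by apply: emeasurable_funD => //; exact: measurable_cst.
- by move=> x Bx; rewrite adde_ge0 ?pphi0 ?lee_fin.
- exact: emeasurable_funD.
- by move=> x _; rewrite adde_ge0.
rewrite (ge0_integralD _ mB (f1 := (w^\+)%E)) in main => //.
rewrite (ge0_integralD _ mB (f1 := fun x => p%:E * phi x)%E) in main => //.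
rewrite !(cstI, WpE, WnE) in main.
have p0 : (0 <= p%:E :> \bar R)%E by rewrite lee_fin ltW.
have c10 : (0 <= c^-1%:E :> \bar R)%E by rewrite lee_fin invr_ge0 ltW.
rewrite (ge0_integralZl _ mB mFB (fun x _ => F_ge0 x) c10) in main.
rewrite (ge0_integralZl _ mB mphi phi0 p0) in main.
move: main; rewrite IE.1 PhiE -!EFinM -!EFinD lee_fin => main.
have cI : c^-1 * I <= V.
  rewrite /c invf_div mulrAC -mulrA ler_piMr ?(ltW V_gt0)//.
  by rewrite ler_pdivrMr// mul1r IE.2.
have pPhi : p * Phi <= p * ((M - L) * V) by rewrite ler_wpM2l// ltW.
have : p * L * V <= Wp - Wn + ln c * V by lra.
by rewrite -ler_pdivlMr// mulrDl mulfK// gt_eqF.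
Qed.

End bound_on_a_ball.

(** * The estimate *)

Section distance_to_complement.
Context (R : realType) (n : nat).
Variables (O : set 'rV[Cplx R]_n) (z : 'rV[Cplx R]_n).

Lemma closed_eball_edistance (r : R) : (r%:E < edistance z (~` O))%E ->
  closed_eball z r `<=` O.
Proof.
move=> rd x xr; apply: contrapT => Ox.
have : (edistance z (~` O) <= (enorm (x - z))%:E)%E.
  by apply: ereal_inf_lbound; exists x.
by move/(lt_le_trans rd); rewrite lte_fin ltNge xr.
Qed.

Lemma exists_radius : open O -> O z ->
  exists2 r : R, 0 < r & (r%:E < edistance z (~` O))%E.
Proof.
move=> oO Oz; have /nbhs_coordP[e e0 H] : nbhs z O by exact: open_nbhs_nbhs.
exists (e / 2); first by rewrite divr_gt0.
apply: (@lt_le_trans _ _ e%:E); first by rewrite lte_fin; lra.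
apply: le_ereal_inf_tmp => _ [x Ox <-]; rewrite lee_fin leNgt; apply/negP => xe.
apply: Ox; apply: H => j; apply: le_lt_trans xe.
by have := modulus_le_enorm (x - z) j; rewrite !mxE.
Qed.

End distance_to_complement.

Local Open Scope ereal_scope.

Theorem mainTheorem1 (R : realType) (n : nat) (n_gt0 : (0 < n)%N)
    (O : set 'rV[Cplx R]_n) (openO : open O) (p : R) (p_gt0 : (0 < p)%R)
    (w : 'rV[Cplx R]_n -> \bar R) (w_loc : locally_integrable_on O w)
    (f : 'rV[Cplx R]_n -> Cplx R) (f_holo : holomorphic_on O f)
    (f_norm : weighted_norm O p w f < +oo)
    (z : 'rV[Cplx R]_n) (Oz : O z) :
  lne (modulus (f z))%:E <=
    (p^-1)%:E * ereal_inf
      [set ball_mean w z r + (2 * n%:R * ln (1 / r))%:E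
        | r in [set r : R | (0 < r)%R /\ r%:E < edistance z (~` O)]]
    + lne (weighted_norm O p w f)
    + (p^-1 * ln (n`!%:R / pi ^+ n))%:E.
Proof.
have [fz0|fz0] := eqVneq (f z) 0%R; first by rewrite fz0 modulus0 le0_lneNy// leNye.
have fz1 : (0 < modulus (f z))%R.
  rewrite lt_neqAle modulus_ge0 andbT eq_sym; apply: contra fz0 => /eqP.
  by move=> /modulus_eq0 ->.
set S := [set _ | _ in _]; set cst_n := (n`!%:R / pi ^+ n)%R.
pose L := ln (modulus (f z)).
set I := \int[lambda]_(x in O) ((modulus (f x) `^ p)%:E * expeR (- w x)).
have I_ge0 : 0 <= I.
  by apply: integral_ge0 => x _; rewrite mule_ge0 ?expeR_ge0// lee_fin powR_ge0.
have p0 : p != 0%R by rewrite gt_eqF.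
have I_fin : I < +oo by apply: (@lty_poweRy _ _ p^-1) f_norm; rewrite invr_neq0.
have cst_n0 : (0 < cst_n)%R by rewrite divr_gt0 ?exprn_gt0 ?pi_gt0// ltr0n fact_gt0.
have bound (J : R) : (0 < J)%R -> I <= J%:E -> forall s, S s ->
    exists2 A, s = A%:E & (p * L <= A + ln cst_n + ln J)%R.
  move=> J0 IJ _ [r [r0 rd] <-].
  have [W WE WL] := log_modulus_le_ball openO p_gt0 w_loc f_holo r0
    (closed_eball_edistance rd) fz0 J0 IJ.
  have V0 : (0 < pi ^+ n / n`!%:R :> R)%R by rewrite divr_gt0 ?exprn_gt0 ?pi_gt0//
    ltr0n fact_gt0.
  have r2n : (0 < r ^+ (2 * n))%R by rewrite exprn_gt0.
  have Vr := mulr_gt0 V0 r2n.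
  exists (W / (pi ^+ n / n`!%:R * r ^+ (2 * n)) + 2 * n%:R * ln (1 / r))%R.
    rewrite /ball_mean WE volume_eball//.
    by rewrite inver gt_eqF// -EFinM -EFinD mulrC.
  apply: le_trans WL _.
  have -> : ln (J / (pi ^+ n / n`!%:R * r ^+ (2 * n))) =
      (ln J - (ln (pi ^+ n / n`!%:R) + ln r *+ (2 * n)))%R.
    by rewrite ln_div ?posrE// lnM ?posrE// lnXn.
  have -> : ln cst_n = (- ln (pi ^+ n / n`!%:R))%R by rewrite -lnV ?posrE// invf_div.
  have -> : ln (1 / r) = (- ln r)%R by rewrite div1r lnV ?posrE.
  by rewrite -[(ln r *+ _)%R]mulr_natr natrM; lra.
have [r0 r00 r0d] := exists_radius openO Oz.
have [s0 Ss0] : exists s0, S s0 by eexists; exists r0.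
case: (ltgtP 0 I) I_ge0 => // [I_gt0|I0] _; last first.
  (* If the integral vanishes then [J] is arbitrary, and [ln J] can be made as
     small as desired: this contradicts [f z != 0]. *)
  have IJ (J : R) : (0 < J)%R -> I <= J%:E by move=> J0; rewrite -I0 lee_fin ltW.
  have [A s0A _] := bound 1%R ltr01 (IJ _ ltr01) _ Ss0.
  have J0 := expR_gt0 (p * L - A - ln cst_n - 1)%R.
  have [A' s0A'] := bound _ J0 (IJ _ J0) _ Ss0.
  move: s0A'; rewrite s0A => -[<-]; rewrite expRK.
  by move=> h; exfalso; lra.
have [J IE] : exists J, I = J%:E 
  by exists (fine I); rewrite fineK// ge0_fin_numE// ltW.
have J0 : (0 < J)%R by rewrite -lte_fin -IE.
have normE : lne (weighted_norm O p w f) = (p^-1 * ln J)%:E.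
  rewrite /weighted_norm -/I IE poweR_EFin lne_EFin ?powR_gt0//.
  by rewrite ln_powR.
have infS : (p * L - ln cst_n - ln J)%:E <= ereal_inf S.
  apply: le_ereal_inf_tmp => s Ss.
  have IJ : I <= J%:E by rewrite IE.
  have [A -> AL] := bound J J0 IJ _ Ss.
  by rewrite lee_fin; lra.
rewrite lne_EFin// normE -addeA -EFinD.
rewrite -leeBlDr// -EFinB.
apply: le_trans (_ : p^-1%:E * (p * L - ln cst_n - ln J)%:E <= _).
  rewrite -EFinM lee_fin -/L le_eqVlt; apply/orP; left; apply/eqP; field.
  exact: p0.
by rewrite lee_pmul2l// lte_fin invr_gt0.
Qed.
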